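(* Let $\alpha\in(1/2,1)$. (i) Let $f\in C_\alpha$ and let $(c_k)_{k\ge1}$ be a sequence of real numbers such that $$\sum_{k=1}^\infty c_k^2\,\sigma_{1-2\alpha+\varepsilon}(k)<\infty$$ for some $\varepsilon>0$. Then the series $\sum_{k=1}^\infty c_kf(kx)$ is convergent in $L^2(0,1)$ norm. (ii) On the other hand, for every $0<\beta<1$ there exist a function $f\in C_\alpha$ and a sequence $(c_k)_{k\ge1}$ of real numbers such that $$\sum_{k=1}^\infty c_k^2\,\bigl(\sigma_{-\alpha}(k)\bigr)^{\beta}<\infty,$$ but the series $\sum_{k=1}^\infty c_kf(kx)$ is not convergent in $L^2(0,1)$ norm.
   Context: For real $s$ and a positive integer $k$, $\sigma_s(k)=\sum_{d\mid k}d^s$ (sum over positive divisors of $k$). The class $C_\alpha$: for $\alpha>1/2$, $C_\alpha$ is the class of measurable functions $f:\mathbb{R}\to\mathbb{R}$ with $f(x+1)=f(x)$, $\int_0^1 f(x)\,dx=0$, $\int_0^1 f^2(x)\,dx<\infty$, whose Fourier series is $\sum_{j=1}^\infty (a_j\sin 2\pi jx+b_j\cos 2\pi jx)$ with $a_j=\mathcal{O}(j^{-\alpha})$ and $b_j=\mathcal{O}(j^{-\alpha})$ as $j\to\infty$. Convergence of a series means convergence of its partial sums $\sum_{k=1}^N$ as $N\to\infty$. *)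

(* Defs.v *)
From mathcomp Require Import all_boot all_order all_algebra.
From mathcomp Require Import all_classical all_reals all_analysis.

Set Implicit Arguments.
Unset Strict Implicit.
Unset Printing Implicit Defensive.

Import Order.TTheory GRing.Theory Num.Theory.
Import numFieldNormedType.Exports.
Local Open Scope classical_set_scope.
Local Open Scope ring_scope.

(* The real line with the sigma-algebra of Lebesgue-measurable (i.e.
   Caratheodory-measurable) sets, on which [completed_lebesgue_measure] is
   defined.  The canonical [measurableType] structure of [R] is the Borel one;
   it is used below only on codomains. *)
Definition lebesgueR (R : realType) : measurableType _ :=
  caratheodory_type (wlength (@idfun R))^*%mu.

Local Notation leb := completed_lebesgue_measure.
Local Notation I01 := (`[0%R, 1%R]%classic : set (lebesgueR _)).
Local Notation J01 := (`]0%R, 1%R[%classic : set (lebesgueR _)).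

Definition lebesgue_measurable (R : realType) (f : R -> R) : Prop :=
  measurable_fun [set: lebesgueR R] (f : lebesgueR R -> R).

(* Meant for k >= 1: [divisors 0] is empty. *)
Definition sigma (R : realType) (s : R) (k : nat) : R :=
  \sum_(d <- divisors k) d%:R `^ s.

Definition sin_coef (R : realType) (f : R -> R) (j : nat) : R :=
  2 * \int[leb]_(x in I01) (f x * sin (2 * pi * j%:R * x)).

Definition cos_coef (R : realType) (f : R -> R) (j : nat) : R :=
  2 * \int[leb]_(x in I01) (f x * cos (2 * pi * j%:R * x)).

(* Since the integral of f over [0, 1] vanishes, so does the constant term of
   its Fourier series. *)
Definition class_C (R : realType) (alpha : R) (f : R -> R) : Prop :=
  [/\ lebesgue_measurable f,
      forall x, f (x + 1) = f x,
      (\int[leb]_(x in I01) (f x)%:E = 0)%E,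
      (\int[leb]_(x in I01) (f x ^+ 2)%:E < +oo)%E
    & (sin_coef f : nat -> R^o) =O_\oo (fun j => j%:R `^ (- alpha) : R^o) /\
      (cos_coef f : nat -> R^o) =O_\oo (fun j => j%:R `^ (- alpha) : R^o)].

(* The norm of L^2(0, 1): the restriction [f \_ D] is f on D and 0 elsewhere. *)
Definition L2norm (R : realType) (f : R -> R) : \bar R :=
  'N[leb]_2%:E[EFin \o ((f : lebesgueR R -> R) \_ J01)%R]%E.

Definition cvg_L2 (R : realType) (S : nat -> R -> R) : Prop :=
  exists g : R -> R,
    [/\ lebesgue_measurable g, (L2norm g < +oo)%E
      & L2norm (S N \- g) @[N --> \oo] --> 0%E].

Definition dilated_sum (R : realType) (c : nat -> R) (f : R -> R) (N : nat)
    (x : R) : R :=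
  \sum_(1 <= k < N.+1) c k * f (k%:R * x).

(* Main.v *)
Require Import Defs.
From HB Require Import structures.
From mathcomp Require Import all_boot all_order all_algebra.
From mathcomp Require Import ring lra.
From mathcomp Require Import all_classical all_reals all_analysis.
From mathcomp Require Import measurable_realfun.
Import Order.TTheory GRing.Theory Num.Theory.
Import numFieldNormedType.Exports.
Local Open Scope classical_set_scope.
Local Open Scope ring_scope.

(** The n-th Fourier coefficient of [sum_k c_k f(kx)] is the divisor sum
    [sum_(jk = n) c_k a_j].  When [|a_j| <= C j^-alpha], its squared norm is at most a multiple of
    [sum |c_k c_l| (ij)^-alpha] over [jk = il], and weighting [|c_k c_l|] by powers of [i / j] in
    the AM-GM inequality bounds this by [sum c_k^2 sigma_(1 - 2 alpha + eps)(k)].  This is applied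
    to partial sums of the Fourier series of [f], which converge to [f] in L^2 because the
    trigonometric system is complete, and passes to [f] since dilation by an integer is an
    isometry on 1-periodic functions.

    For the converse take [a_j = j^-alpha] (sines only) and let [c] be constant on the divisors of
    a highly divisible [Q].  By Bessel's inequality the squared norm is at least half of
    [c^2 sum_(n | Q) sigma_(-alpha)(n)^2 >= c^2 tau(Q) sigma_(-alpha)(Q)], whereas the weighted
    series is at most [c^2 tau(Q) sigma_(-alpha)(Q)^beta].  Since [sigma_(-alpha)(N!)] is
    unbounded, combining such blocks makes the norms of the partial sums unbounded. *)

(** * Completeness of L^2 *)

(** The statement concerns Lebesgue-measurable functions and the completed measure; the analysis is
    carried out for Borel functions and [lebesgue_measure]. The bridge is a Borel representative of
    [f] that is still 1-periodic, so that dilation remains an isometry, together with one null set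
    serving all partial sums.

    Square integrals replace norms: (u + v)^2 <= 2 u^2 + 2 v^2 costs only constants. The truncation
    of the Fourier series is removed crudely, with an error factor exponential in the number of
    dilates; this is harmless because the dilates are fixed before the truncation order, and the
    bound for trigonometric sums is uniform in that order.

    In the converse the blocks overlap, since each contains the divisors of the previous moduli.
    Nonnegativity settles this: no terms cancel, so raising a coefficient only raises the divisor
    sums, and each [k] can take the largest weight among its blocks. The gap between the exponents 1
    and [beta] leaves a factor sigma^(1 - beta), made to outgrow the summable factors 2^-r. *)

Definition sqint {d} {T : measurableType d} {R : realType}
    (mu : {measure set T -> \bar R}) (D : set T) (u : T -> R) : \bar R :=
  \int[mu]_(x in D) ((u x) ^+ 2)%:E.

Section SquareIntegral.
Context {d} {T : measurableType d} {R : realType}.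
Context (mu : {measure set T -> \bar R}) (D : set T) (mD : measurable D).
Implicit Types u v : T -> R.

Lemma measurable_sqr u :
  measurable_fun setT u -> measurable_fun D (fun x => ((u x) ^+ 2)%:E : \bar R).
Proof.
move=> mu_; apply: measurable_funTS.
by apply/measurable_EFinP; exact: measurable_funX.
Qed.

Lemma sqint_ge0 u : (0 <= sqint mu D u)%E.
Proof. by apply: integral_ge0 => x _; rewrite lee_fin sqr_ge0. Qed.

Lemma sqintZ (c : R) u : measurable_fun setT u ->
  sqint mu D (fun x => c * u x) = ((c ^+ 2)%:E * sqint mu D u)%E.
Proof.
move=> mu_; rewrite /sqint -ge0_integralZl//; first last.
- by rewrite lee_fin sqr_ge0.
- by move=> x _; rewrite lee_fin sqr_ge0.
- exact: measurable_sqr.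
by apply: eq_integral => x _; rewrite -EFinM exprMn.
Qed.

Lemma sqintD_le u v : measurable_fun setT u -> measurable_fun setT v ->
  (sqint mu D (fun x => u x + v x)%R <= 2%:E * sqint mu D u + 2%:E * sqint mu D v)%E.
Proof.
move=> mu_ mv; rewrite -ge0_integralZl//; first last.
- by move=> x _; rewrite lee_fin sqr_ge0.
- exact: measurable_sqr.
rewrite -[X in (_ + X)%E]ge0_integralZl//; first last.
- by move=> x _; rewrite lee_fin sqr_ge0.
- exact: measurable_sqr.
rewrite -ge0_integralD//; first last.
- by apply: measurable_funeM; exact: measurable_sqr.
- by move=> x _; rewrite -EFinM lee_fin mulr_ge0// sqr_ge0.
- by apply: measurable_funeM; exact: measurable_sqr.
- by move=> x _; rewrite -EFinM lee_fin mulr_ge0// sqr_ge0.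
apply: ge0_le_integral => //.
- by move=> x _; rewrite lee_fin sqr_ge0.
- by apply: measurable_sqr; exact: measurable_funD.
- by apply: emeasurable_funD; apply: measurable_funeM; exact: measurable_sqr.
move=> x _; rewrite -!EFinM -EFinD lee_fin.
have := sqr_ge0 (u x - v x); nra.
Qed.

(** Each use of [sqintD_le] doubles the constant. The exponential loss is affordable because the
    lemma is applied to a fixed list of dilates of an arbitrarily small function. *)
Lemma sqint_sum_le (I : Type) (s : seq I) (u : I -> T -> R) :
  (forall i, measurable_fun setT (u i)) ->
  (sqint mu D (fun x => (\sum_(i <- s) u i x)%R) <=
   (2 ^+ size s)%:E * \sum_(i <- s) sqint mu D (u i))%E.
Proof.
move=> mu_; elim: s => [|i s ih].
  rewrite !big_nil mule0 /sqint.
  rewrite (eq_integral (cst 0%E)) ?integral0//.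
  by move=> x _; rewrite big_nil expr0n.
rewrite !big_cons.
under [X in sqint _ _ X]eq_fun do rewrite big_cons.
apply: le_trans (sqintD_le _ _ _ _) _ => //; first exact: measurable_sum.
rewrite [leRHS]ge0_muleDr; last 2 first.
- exact: sqint_ge0.
- by apply: sume_ge0 => k _; exact: sqint_ge0.
apply: leeD.
  apply: lee_wpmul2r; first exact: sqint_ge0.
  by rewrite lee_fin exprS /= ler_peMr// exprn_ege1// ler1n.
rewrite /= exprS EFinM -muleA.
by apply: lee_wpmul2l; rewrite ?lee_fin.
Qed.

End SquareIntegral.

Lemma limn_einf_le {R : realType} (a : nat -> \bar R) (e : \bar R) (n0 : nat) :
  (forall n, (n0 <= n)%N -> (a n <= e)%E) -> (limn_einf a <= e)%E.
Proof.
move=> ae; rewrite limn_einf_lim; apply: lime_le; first exact: is_cvg_einfs.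
apply: nearW => n; apply: le_trans (ae (maxn n n0) (leq_maxr _ _)).
by apply: ereal_inf_lbound; exists (maxn n n0) => //=; exact: leq_maxl.
Qed.

(* [Phi] is applied pointwise, so that the limit inherits e.g. the periodicity of the sequence. *)
Lemma sqint_complete {d} {T : measurableType d} {R : realType}
    (mu : {measure set T -> \bar R}) (D : set T) (S : nat -> T -> R) :
  measurable D -> (forall n, measurable_fun setT (S n)) ->
  (forall e : R, 0 < e -> exists N, forall m n, (N <= m)%N -> (N <= n)%N ->
    (sqint mu D (fun x => S m x - S n x)%R <= e%:E)%E) ->
  exists Phi : (nat -> R) -> R,
    measurable_fun setT (fun x => Phi (S ^~ x)) /\
    forall e : R, 0 < e -> exists N, forall n, (N <= n)%N ->
      (sqint mu D (fun x => S n x - Phi (S ^~ x))%R <= e%:E)%E.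
Proof.
move=> mD mS cS.
(* The factor 2^-(r+1) is the summable budget of [epsilon_trick0]; the factor 2^-r pays for the
   weight 2^r in [h] below. *)
pose tol r : R := 1 / (2 ^ r.+1)%:R / 2 ^+ r.
have tol0 r : 0 < tol r by rewrite !divr_gt0// ?exprn_gt0// ltr0n expn_gt0.
have {}/choice[nu nuP] : forall r, exists N, forall m n, (N <= m)%N -> (N <= n)%N ->
    (sqint mu D (fun x => S m x - S n x)%R <= (tol r)%:E)%E.
  by move=> r; exact: cS.
pose k r := (\sum_(i < r.+1) (nu i).+1)%N.
have kS r : (k r <= k r.+1)%N by rewrite /k [leqRHS]big_ord_recr/= leq_addr.
have knu r : (nu r <= k r)%N.
  by rewrite /k big_ord_recr/= (leq_trans (leqnSn _))// leq_addl.
have kr r : (r <= k r)%N.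
  elim: r => // r ih; rewrite /k big_ord_recr/= -/(k r).
  by rewrite -addn1 leq_add.
pose u r x := S (k r.+1) x - S (k r) x.
have mu_ r : measurable_fun setT (u r) by exact: measurable_funB.
(* Where [h] is finite the increments are absolutely summable, because |u r| <= 2^r (u r)^2 +
   2^-r. *)
pose h x : \bar R := (\sum_(0 <= r <oo) ((2 ^+ r * (u r x) ^+ 2)%R)%:E)%E.
have mterm r : measurable_fun D (fun x => ((2 ^+ r * (u r x) ^+ 2)%R)%:E).
  apply: measurable_funTS; apply/measurable_EFinP; apply: measurable_funM => //.
  exact: measurable_funX.
have h0 r x : (0 <= ((2 ^+ r * (u r x) ^+ 2)%R)%:E)%E.
  by rewrite lee_fin mulr_ge0 ?sqr_ge0 ?exprn_ge0.
have inth : (\int[mu]_(x in D) h x <= 1%:E)%E.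
  rewrite integral_nneseries//.
  apply: le_trans (@epsilon_trick0 R 1 xpredT ler01).
  apply: lee_nneseries => [r _ _|r _]; first by apply: integral_ge0 => x _.
  under eq_integral do rewrite EFinM.
  rewrite ge0_integralZl//; first last.
  - by move=> x _; rewrite lee_fin sqr_ge0.
  - exact: measurable_sqr.
  have := nuP r (k r.+1) (k r) (leq_trans (knu r) (kS r)) (knu r).
  rewrite -/(u r) => H.
  apply: (@le_trans _ _ ((2 ^+ r)%:E * (tol r)%:E)%E).
    by apply: lee_wpmul2l => //; rewrite lee_fin exprn_ge0.
  by rewrite -EFinM lee_fin /tol mulrC divfK// expf_neq0.
have ih : mu.-integrable D h.
  apply/integrableP; split.
    by apply: ge0_emeasurable_sum => // r x _ _.
  rewrite (eq_integral h).
    by rewrite (le_lt_trans inth)// ltry.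
  by move=> x _; rewrite gee0_abs//; exact: nneseries_ge0.
(* An upper limit exists for every sequence and is measurable; it is the limit wherever the
   subsequence converges. *)
pose Phi (s : nat -> R) := fine (limn_esup (fun r => (s (k r))%:E)).
have mPhi : measurable_fun setT (fun x => Phi (S ^~ x)).
  apply: (@measurableT_comp _ _ _ _ _ _ fine) => //.
  apply: measurable_fun_limn_esup => r.
  by apply/measurable_EFinP.
have aecvg : {ae mu, forall x, D x -> S (k r) x @[r --> \oo] --> Phi (S ^~ x)}.
  apply: filterS (integrable_ae mD ih) => x hx Dx.
  have {}hx := hx Dx.
  have cq : cvgn (series (fun r => 2 ^+ r * (u r x) ^+ 2)).
    apply: nnseries_is_cvg; first by move=> r; rewrite mulr_ge0 ?sqr_ge0 ?exprn_ge0.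
    by rewrite -ge0_fin_numE//; exact: nneseries_ge0.
  have cg : cvgn (series (geometric 1 (2^-1 : R))).
    by apply: is_cvg_geometric_series; rewrite ger0_norm ?invr_ge0// invf_lt1// ltr1n.
  have cu : cvgn (series (u ^~ x)).
    apply: normed_cvg.
    apply: (@series_le_cvg _ _ (fun r => 2 ^+ r * (u r x) ^+ 2 + geometric 1 (2^-1 : R) r)).
    - by move=> r /=.
    - by move=> r /=; apply: addr_ge0; apply: mulr_ge0; rewrite ?sqr_ge0 ?exprn_ge0 ?invr_ge0 ?ler0n ?ler01.
    - move=> r /=; rewrite mul1r exprVn -real_normK ?num_real//.
      set a := `|u r x|; set b : R := 2 ^+ r.
      have b0 : 0 < b by rewrite exprn_gt0.
      have := sqr_ge0 (b * a - 1) => H.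
      rewrite -(ler_pM2l b0) mulrDr divff ?gt_eqF//.
      have a0 : 0 <= a by exact: normr_ge0.
      nra.
    - by rewrite (_ : series _ = series (fun r => 2 ^+ r * (u r x) ^+ 2) + series (geometric 1 (2^-1 : R))); [exact: is_cvgD|rewrite -seriesD].
  have cS' : cvgn (fun r => S (k r) x).
    have -> : (fun r => S (k r) x) = cst (S (k 0) x) + series (u ^~ x).
      apply/funext => r /=.
      by rewrite (eq_sum_telescope (fun r => S (k r) x) r).
    by apply: is_cvgD => //; exact: is_cvg_cst.
  have -> : Phi (S ^~ x) = limn (fun r => S (k r) x); last exact: cS'.
  rewrite /Phi (@cvg_limn_einf_sup _ _ (limn (fun r => S (k r) x))%:E)//.
  by apply/cvg_EFin => //; exact: nearW.
exists Phi; split => // e e0.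
have [N NP] := cS e e0; exists N => n Nn.
(* Fatou's lemma along the subsequence: almost everywhere the integrand is the lower limit of the
   squares of [S n - S (k r)], whose integrals are at most [e]. *)
apply: (@le_trans _ _ (\int[mu]_(x in D) limn_einf (fun r => ((S n x - S (k r) x) ^+ 2)%:E))%E).
  rewrite le_eqVlt; apply/orP; left; apply/eqP.
  apply: ge0_ae_eq_integral => //.
  - by apply: measurable_sqr => //; exact: measurable_funB.
  - rewrite (_ : (fun x => _) = (fun x => - limn_esup (fun r => - ((S n x - S (k r) x) ^+ 2)%:E))%E).
      apply: measurableT_comp => //; apply: measurable_fun_limn_esup => r.
      by apply: measurableT_comp => //; apply: measurable_sqr => //; exact: measurable_funB.
    apply/funext => x; rewrite -limn_einfN; congr limn_einf.
    by apply/funext => r /=; rewrite opprK.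
  - by move=> x _; rewrite lee_fin sqr_ge0.
  - move=> x _; rewrite limn_einf_lim; apply: lime_ge; first exact: is_cvg_einfs.
    apply: nearW => m; apply: le_ereal_inf_tmp => _ [r _ <-].
    by rewrite lee_fin sqr_ge0.
  apply: filterS aecvg => x hx Dx.
  rewrite (@cvg_limn_einf_sup _ _ ((S n x - Phi (S ^~ x)) ^+ 2)%:E)//.
  apply/cvg_EFin; first exact: nearW.
  have hB : S n x - S (k r) x @[r --> \oo] --> S n x - Phi (S ^~ x).
    by apply: cvgB; [exact: cvg_cst|exact: hx].
  exact: (cvgM hB hB).
apply: le_trans (fatou _ _ _ _) _ => //.
- by move=> r; apply: measurable_sqr => //; exact: measurable_funB.
- by move=> r x _; rewrite lee_fin sqr_ge0.
apply: (@limn_einf_le _ _ _ N) => r Nr; apply: NP => //.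
exact: leq_trans Nr (kr r).
Qed.

(** * Trigonometric functions on [0, 1] *)

Section Integral01.
Context {R : realType}.
Implicit Types u v h : R -> R.

Definition int01 u : R := \int[lebesgue_measure]_(x in `[0%R, 1%R]) u x.

Definition integrable01 u : Prop :=
  lebesgue_measure.-integrable `[0%R, 1%R] (EFin \o u).

(** The class of multipliers: it is closed under sums and products, contains all trigonometric sums,
    and multiplication by its members preserves integrability. *)
Definition bounded_borel u : Prop :=
  measurable_fun setT u /\ exists M, forall x, `|u x| <= M.

Lemma bounded_borel_cst (c : R) : bounded_borel (fun=> c).
Proof. by split; [exact: measurable_cst | exists `|c|]. Qed.

Lemma bounded_borelD u v : bounded_borel u -> bounded_borel v ->
  bounded_borel (fun x => u x + v x).
Proof.
move=> [mu [M uM]] [mv [N vN]]; split; first exact: measurable_funD.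
by exists (M + N) => x; rewrite (le_trans (ler_normD _ _))// lerD.
Qed.

Lemma bounded_borelM u v : bounded_borel u -> bounded_borel v ->
  bounded_borel (fun x => u x * v x).
Proof.
move=> [mu [M uM]] [mv [N vN]]; split; first exact: measurable_funM.
by exists (M * N) => x; rewrite normrM ler_pM.
Qed.

Lemma bounded_borelX u n : bounded_borel u -> bounded_borel (fun x => u x ^+ n).
Proof.
move=> [mu [M uM]]; split; first exact: measurable_funX.
by exists (M ^+ n) => x; rewrite normrX lerXn2r ?nnegrE// (le_trans _ (uM x)).
Qed.

Lemma bounded_borel_sum (I : Type) (s : seq I) (P : pred I) (u : I -> R -> R) :
  (forall i, bounded_borel (u i)) ->
  bounded_borel (fun x => \sum_(i <- s | P i) u i x).
Proof.
move=> bu; elim: s => [|i s ih].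
  under eq_fun do rewrite big_nil; exact: bounded_borel_cst.
under eq_fun do rewrite big_cons.
by case: (P i) => //; exact: bounded_borelD.
Qed.

Lemma integrable01M h u :
  integrable01 h -> bounded_borel u -> integrable01 (fun x => h x * u x).
Proof.
move=> ih [mu [M uM]].
apply: (integrableMl _ ih) => //; first exact: measurable_funTS.
exists M; split; first exact: num_real.
move=> N MN x _ /=; exact: le_trans (uM x) (ltW MN).
Qed.

Lemma integrable01_cst (c : R) : integrable01 (fun=> c).
Proof.
apply/integrableP; split; first by exact/measurable_EFinP/measurable_cst.
rewrite integral_cst//= lebesgue_measure_itv/= lte_fin ltr01 oppr0 adde0 mule1.
by rewrite ltry.
Qed.

Lemma bounded_borel_integrable01 u : bounded_borel u -> integrable01 u.
Proof.
move=> bu; rewrite (_ : u = fun x => 1 * u x).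
  exact/integrable01M/bu/integrable01_cst.
by apply/funext => x; rewrite mul1r.
Qed.

Lemma integrable01D u v : integrable01 u -> integrable01 v ->
  integrable01 (fun x => u x + v x).
Proof. by move=> iu iv; exact: (integrableD _ iu iv). Qed.

Lemma integrable01Z (c : R) u : integrable01 u -> integrable01 (fun x => c * u x).
Proof. by move=> iu; exact: (integrableZl _ c iu). Qed.

Lemma int01D u v : integrable01 u -> integrable01 v ->
  int01 (fun x => u x + v x) = int01 u + int01 v.
Proof. by move=> iu iv; rewrite /int01 RintegralD. Qed.

Lemma int01B u v : integrable01 u -> integrable01 v ->
  int01 (fun x => u x - v x) = int01 u - int01 v.
Proof. by move=> iu iv; rewrite /int01 RintegralB. Qed.

Lemma int01Z (c : R) u : integrable01 u -> int01 (fun x => c * u x) = c * int01 u.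
Proof. by move=> iu; rewrite /int01 RintegralZl. Qed.

Lemma integrable01_sum (I : Type) (s : seq I) (P : pred I) (u : I -> R -> R) :
  (forall i, integrable01 (u i)) ->
  integrable01 (fun x => \sum_(i <- s | P i) u i x).
Proof.
move=> iu; elim: s => [|i s ih].
  under eq_fun do rewrite big_nil; exact: integrable01_cst.
under eq_fun do rewrite big_cons.
by case: (P i) => //; exact: integrable01D.
Qed.

Lemma int01_sum (I : Type) (s : seq I) (P : pred I) (u : I -> R -> R) :
  (forall i, integrable01 (u i)) ->
  int01 (fun x => \sum_(i <- s | P i) u i x) = \sum_(i <- s | P i) int01 (u i).
Proof.
move=> iu; elim: s => [|i s ih].
  rewrite big_nil -[RHS](mul0r (int01 (fun=> 0))) -int01Z; last exact: integrable01_cst.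
  by congr int01; apply/funext => x; rewrite big_nil mul0r.
rewrite big_cons; under eq_fun do rewrite big_cons.
case: (P i) => //; rewrite int01D ?ih//; exact: integrable01_sum.
Qed.

Lemma sqint01E u : integrable01 (fun x => u x ^+ 2) ->
  sqint lebesgue_measure `[0%R, 1%R] u = (int01 (fun x => u x ^+ 2))%:E.
Proof. by move=> iu; rewrite /int01 /Rintegral fineK//; exact: integrable_fin_num. Qed.

End Integral01.

Section Trigonometric.
Context {R : realType}.
Local Notation i01 := (@int01 R).

(** [true] stands for sine and [false] for cosine. At frequency 0 they are the constants 0 and 1, so
    the mean of a function is its cosine integral there. *)
Definition trig (b : bool) (n : nat) (x : R) : R :=
  if b then sin (2 * pi * n%:R * x) else cos (2 * pi * n%:R * x).

Lemma measurable_trig b n : measurable_fun setT (trig b n).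
Proof.
apply: continuous_measurable_fun => x.
have mulC : {for x, continuous (fun x : R => 2 * pi * n%:R * x)}.
  exact: mulrl_continuous.
case: b; rewrite /trig.
  by apply: continuous_comp => //; exact: continuous_sin.
by apply: continuous_comp => //; exact: continuous_cos.
Qed.

Lemma trig_le1 b n x : `|trig b n x| <= 1.
Proof. by case: b; rewrite /trig ?sin_max ?cos_max. Qed.

Lemma bounded_borel_trig b n : bounded_borel (trig b n).
Proof. by split; [exact: measurable_trig | exists 1 => x; exact: trig_le1]. Qed.

Lemma trig_mul b n k x : trig b n (k%:R * x) = trig b (n * k) x.
Proof. by rewrite /trig natrM !mulrA. Qed.

(** Membership in 2 pi Z, stated as the two values that decide the boundary terms of a primitive.
    Unlike natural frequencies, it is closed under differences. *)
Definition full_period (c : R) := sin c = 0 /\ cos c = 1.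

Lemma full_periodD c e : full_period c -> full_period e -> full_period (c + e).
Proof.
move=> [sc cc] [se ce]; split.
  by rewrite sinD sc se cc ce !(mul0r, mulr0) addr0.
by rewrite cosD sc se cc ce mulr1 mulr0 subr0.
Qed.

Lemma full_periodB c e : full_period c -> full_period e -> full_period (c - e).
Proof.
move=> pc [se ce]; apply: full_periodD => //.
by split; rewrite ?sinN ?cosN ?se ?ce ?oppr0.
Qed.

Lemma full_period_nat n : full_period (2 * pi * n%:R).
Proof.
elim: n => [|n ih]; first by rewrite mulr0; split; rewrite ?sin0 ?cos0.
rewrite -[n.+1%:R]natr1 mulrDr; apply: full_periodD => //.
by rewrite mulr1 mulr_natl; split; rewrite ?sin2pi ?cos2pi.
Qed.

Lemma trig1 b n x : trig b n (x + 1) = trig b n x.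
Proof.
have [sn cn] := full_period_nat n.
by case: b; rewrite /trig mulrDr mulr1 ?sinD ?cosD sn cn mulr1 mulr0 ?addr0 ?subr0.
Qed.

Lemma is_derive_scale (f : R -> R) (c x l : R) :
  is_derive (c * x) 1 f l -> is_derive x 1 (fun y : R => f (c * y)) (c * l).
Proof.
move=> df; have dc : is_derive x 1 (fun y : R => c * y) c.
  rewrite [X in is_derive _ _ _ X](_ : c = c *: (1 : R)); last by rewrite /GRing.scale/= mulr1.
  exact: is_deriveZ.
rewrite [c * l]mulrC; exact: (@is_derive1_comp _ f (fun y => c * y) x l c).
Qed.

Lemma FTC01 (f F : R -> R) : (forall x : R, is_derive x 1 F (f x)) -> continuous f ->
  i01 f = F 1 - F 0.
Proof.
move=> dF cf; have cF : continuous F.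
  by move=> x; apply/differentiable_continuous/derivable1_diffP; case: (dF x).
rewrite /int01 /Rintegral (@continuous_FTC2 _ f F 0 1)//.
- exact: continuous_subspaceT.
- split; first by move=> x _; case: (dF x).
  + by apply: cvg_at_right_filter; exact: cF.
  + by apply: cvg_at_left_filter; exact: cF.
- by move=> x _; rewrite derive1E; case: (dF x).
Qed.

Lemma int01_cos (c : R) : full_period c -> i01 (fun x => cos (c * x)) = (c == 0)%:R.
Proof.
move=> [sc cc]; have [->|c0] := eqVneq c 0.
  rewrite (_ : (fun x => _) = fun=> 1); last by apply/funext => x; rewrite mul0r cos0.
  rewrite /int01 Rintegral_cst//= lebesgue_measure_itv/= lte_fin ltr01.
  by rewrite oppr0 adde0 mulr1.
have dF (x : R) : is_derive x 1 (fun y => c^-1 * sin (c * y)) (cos (c * x)).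
  rewrite [X in is_derive _ _ _ X](_ : _ = c^-1 *: (c * cos (c * x))); last first.
    by rewrite /GRing.scale/= mulrA mulVf// mul1r.
  exact/is_deriveZ/is_derive_scale.
have cf : continuous (fun x => cos (c * x)).
  by move=> x; apply: continuous_comp; [exact: mulrl_continuous|exact: continuous_cos].
by rewrite (FTC01 _ _ dF cf) mulr1 mulr0 sin0 sc mulr0 subr0.
Qed.

Lemma int01_sin (c : R) : full_period c -> i01 (fun x => sin (c * x)) = 0.
Proof.
move=> [sc cc]; have [->|c0] := eqVneq c 0.
  rewrite (_ : (fun x => _) = fun=> 0); last by apply/funext => x; rewrite mul0r sin0.
  by rewrite /int01 Rintegral_cst//= mul0r.
have dF (x : R) : is_derive x 1 (fun y => - c^-1 * cos (c * y)) (sin (c * x)).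
  rewrite [X in is_derive _ _ _ X](_ : _ = - c^-1 *: (c * - sin (c * x))); last first.
    by rewrite /GRing.scale/= mulrN mulNr mulrN opprK mulrA mulVf// mul1r.
  exact/is_deriveZ/is_derive_scale.
have cf : continuous (fun x => sin (c * x)).
  by move=> x; apply: continuous_comp; [exact: mulrl_continuous|exact: continuous_sin].
by rewrite (FTC01 _ _ dF cf) mulr1 mulr0 cos0 cc subrr.
Qed.

Lemma bounded_borel_scale_comp (f : R -> R) (c : R) : continuous f ->
  bounded_borel f -> bounded_borel (fun x => f (c * x)).
Proof.
move=> cf [_ [M fM]]; split; last by exists M.
apply: continuous_measurable_fun => x.
by apply: continuous_comp; [exact: mulrl_continuous | exact: cf].
Qed.

Lemma bounded_borel_cos (c : R) : bounded_borel (fun x => cos (c * x)).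
Proof.
apply: bounded_borel_scale_comp; first exact: continuous_cos.
split; last by exists 1 => x; exact: cos_max.
by apply: continuous_measurable_fun => x; exact: continuous_cos.
Qed.

Lemma bounded_borel_sin (c : R) : bounded_borel (fun x => sin (c * x)).
Proof.
apply: bounded_borel_scale_comp; first exact: continuous_sin.
split; last by exists 1 => x; exact: sin_max.
by apply: continuous_measurable_fun => x; exact: continuous_sin.
Qed.

(** The product-to-sum formulas leave the frequencies m + n and m - n. Positivity of [m] keeps the
    first nonzero, so only the second can contribute to the integral. *)
Lemma trig_orthogonal b m b' n : (0 < m)%N ->
  i01 (fun x => trig b m x * trig b' n x) = 2^-1 * ((b == b') && (m == n))%:R.
Proof.
move=> m0; pose p : R := 2 * pi * m%:R; pose q : R := 2 * pi * n%:R.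
have pp : full_period p by exact: full_period_nat.
have pq : full_period q by exact: full_period_nat.
have pi2 : 0 < 2 * pi :> R by rewrite mulr_gt0// pi_gt0.
have pq0 : (p + q == 0) = false.
  by rewrite /p /q -mulrDr -natrD mulf_eq0 (gt_eqF pi2) pnatr_eq0 addn_eq0 (gtn_eqF m0).
have pBq : (p - q == 0) = (m == n).
  by rewrite subr_eq0 /p /q (inj_eq (mulfI (negbT (gt_eqF pi2)))) eqr_nat.
have iC (c : R) : integrable01 (fun x => cos (c * x)).
  exact: bounded_borel_integrable01 (bounded_borel_cos c).
have iS (c : R) : integrable01 (fun x => sin (c * x)).
  by apply: bounded_borel_integrable01; exact: bounded_borel_sin.
rewrite /trig -/p -/q; case: b; case: b' => /=.
- rewrite (_ : (fun x => _) = fun x => 2^-1 * cos ((p - q) * x) + (- 2^-1) * cos ((p + q) * x)).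
    rewrite int01D ?int01Z//; try exact: integrable01Z.
    rewrite !int01_cos ?pq0 ?pBq ?mulr0 ?addr0//; [exact: full_periodD|exact: full_periodB].
  by apply/funext => x; rewrite mulrBl mulrDl cosB cosD; field.
- rewrite (_ : (fun x => _) = fun x => 2^-1 * sin ((p - q) * x) + 2^-1 * sin ((p + q) * x)).
    rewrite int01D ?int01Z//; try exact: integrable01Z.
    rewrite !int01_sin ?mulr0 ?addr0//; [exact: full_periodD|exact: full_periodB].
  by apply/funext => x; rewrite mulrBl mulrDl sinB sinD; field.
- rewrite (_ : (fun x => _) = fun x => (- 2^-1) * sin ((p - q) * x) + 2^-1 * sin ((p + q) * x)).
    rewrite int01D ?int01Z//; try exact: integrable01Z.
    rewrite !int01_sin ?mulr0 ?addr0//; [exact: full_periodD|exact: full_periodB].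
  by apply/funext => x; rewrite mulrBl mulrDl sinB sinD; field.
- rewrite (_ : (fun x => _) = fun x => 2^-1 * cos ((p - q) * x) + 2^-1 * cos ((p + q) * x)).
    rewrite int01D ?int01Z//; try exact: integrable01Z.
    rewrite !int01_cos ?pq0 ?pBq ?mulr0 ?addr0//; [exact: full_periodD|exact: full_periodB].
  by apply/funext => x; rewrite mulrBl mulrDl cosB cosD; field.
Qed.

End Trigonometric.

(** * Completeness of the trigonometric system *)

Section TrigonometricPolynomials.
Context {R : realType}.
Implicit Types u v h : R -> R.

(** An inductive span instead of coefficient lists: closure under products and powers, required to
    compose with [threshold], is then an induction, and so is vanishing of integrals against [h]. *)
Inductive trigpoly : (R -> R) -> Prop :=
| trigpoly_trig b n : trigpoly (trig b n)
| trigpolyZ c u : trigpoly u -> trigpoly (fun x => c * u x)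
| trigpolyD u v : trigpoly u -> trigpoly v -> trigpoly (fun x => u x + v x).

Lemma trigpoly_cst (c : R) : trigpoly (fun=> c).
Proof.
rewrite (_ : (fun=> c) = fun x => c * trig false 0 x); first exact/trigpolyZ/trigpoly_trig.
by apply/funext => x; rewrite /trig mulr0 mul0r cos0 mulr1.
Qed.

Lemma trigpoly_trigM b m b' n : trigpoly (fun x => trig b m x * trig b' n x).
Proof.
(* Frequencies are natural numbers, so the difference frequency [m - n] is genuine only for
   [n <= m]. *)
wlog nm : b m b' n / (n <= m)%N.
  move=> H; have [|/ltnW] := leqP n m; first exact: H.
  move=> /(H b' n b m) hyp; rewrite (_ : (fun x => _) = fun x => trig b' n x * trig b m x)//.
  by apply/funext => x; rewrite mulrC.
have E (c c' : bool) (e e' : R) :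
    (fun x => trig b m x * trig b' n x) =
    (fun x => e * trig c (m - n) x + e' * trig c (m + n) x) ->
    trigpoly (fun x => trig b m x * trig b' n x).
  by move=> ->; apply: trigpolyD; exact/trigpolyZ/trigpoly_trig.
have pD x : 2 * pi * (m + n)%:R * x = 2 * pi * m%:R * x + 2 * pi * n%:R * x :> R.
  by rewrite natrD; ring.
have pB x : 2 * pi * (m - n)%:R * x = 2 * pi * m%:R * x - 2 * pi * n%:R * x :> R.
  by rewrite natrB//; ring.
move: E; case: b; case: b' => E.
- apply: (E false false (2^-1) (- 2^-1)); apply/funext => x.
  by rewrite /trig pD pB cosB cosD; field.
- apply: (E true true (2^-1) (2^-1)); apply/funext => x.
  by rewrite /trig pD pB sinB sinD; field.
- apply: (E true true (- 2^-1) (2^-1)); apply/funext => x.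
  by rewrite /trig pD pB sinB sinD; field.
- apply: (E false false (2^-1) (2^-1)); apply/funext => x.
  by rewrite /trig pD pB cosB cosD; field.
Qed.

Lemma trigpolyM u v : trigpoly u -> trigpoly v -> trigpoly (fun x => u x * v x).
Proof.
move=> tu tv; elim: tu => {u} [b n|c u _ ih|u w _ ihu _ ihw].
- elim: tv => {v} [b' m|c v _ ih|v w _ ihv _ ihw].
  + exact: trigpoly_trigM.
  + rewrite (_ : (fun x => _) = fun x => c * (trig b n x * v x)); first exact: trigpolyZ.
    by apply/funext => x; rewrite mulrCA.
  + rewrite (_ : (fun x => _) = fun x => trig b n x * v x + trig b n x * w x); first exact: trigpolyD.
    by apply/funext => x; rewrite mulrDr.
- rewrite (_ : (fun x => _) = fun x => c * (u x * v x)); first exact: trigpolyZ.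
  by apply/funext => x; rewrite mulrA.
- rewrite (_ : (fun x => _) = fun x => u x * v x + w x * v x); first exact: trigpolyD.
  by apply/funext => x; rewrite mulrDl.
Qed.

Lemma trigpolyX u n : trigpoly u -> trigpoly (fun x => u x ^+ n).
Proof.
move=> tu; elim: n => [|n ih]; first exact: trigpoly_cst.
rewrite (_ : (fun x => _) = fun x => u x * u x ^+ n); first exact: trigpolyM.
by apply/funext => x; rewrite exprS.
Qed.

Lemma bounded_borel_trigpoly u : trigpoly u -> bounded_borel u.
Proof.
elim=> {u} [b n|c u _ bu|u v _ bu _ bv]; first exact: bounded_borel_trig.
- by apply: bounded_borelM => //; exact: bounded_borel_cst.
- exact: bounded_borelD.
Qed.

Lemma int01_trigpoly_eq0 h u : integrable01 h ->
  (forall b n, int01 (fun x => h x * trig b n x) = 0) ->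
  trigpoly u -> int01 (fun x => h x * u x) = 0.
Proof.
move=> ih h0; elim=> {u} [b n|c u tu hu|u v tu hu tv hv]; first exact: h0.
- rewrite (_ : (fun x => _) = fun x => c * (h x * u x)).
    by rewrite int01Z ?hu ?mulr0//; exact/integrable01M/bounded_borel_trigpoly.
  by apply/funext => x; rewrite mulrCA.
- rewrite (_ : (fun x => _) = fun x => h x * u x + h x * v x).
    by rewrite int01D ?hu ?hv ?addr0//; exact/integrable01M/bounded_borel_trigpoly.
  by apply/funext => x; rewrite mulrDr.
Qed.

End TrigonometricPolynomials.

Section Threshold.
Context {R : realType}.

(* With [m ~ t^-n], [(1 - w^n)^m ~ exp (- (w / t)^n)] jumps from 1 to 0 as [w] crosses [t]. *)
Definition threshold (t : R) (n : nat) (w : R) : R :=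
  1 - (1 - w ^+ n) ^+ (Num.truncn (t ^- n)).+1.

Lemma bernoulli (y : R) m : 0 <= y <= 1 -> 1 - m%:R * y <= (1 - y) ^+ m.
Proof.
move=> /andP[y0 y1]; elim: m => [|m ih]; first by rewrite mul0r subr0 expr0.
rewrite exprS; have : (1 - y) * (1 - m%:R * y) <= (1 - y) * (1 - y) ^+ m.
  by rewrite ler_wpM2l// subr_ge0.
apply: le_trans; rewrite -natr1.
have : 0 <= m%:R * y ^+ 2 by rewrite mulr_ge0 ?sqr_ge0.
by rewrite expr2; nra.
Qed.

(** Multiply (1 - y)^m by (1 + y)^m >= m y: the product is (1 - y^2)^m <= 1. *)
Lemma expr_1B_le (y : R) m : 0 < y <= 1 -> (1 - y) ^+ m.+1 <= (m.+1%:R * y)^-1.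
Proof.
move=> /andP[y0 y1]; have my : 0 < m.+1%:R * y by rewrite mulr_gt0.
rewrite -[leRHS]mul1r ler_pdivlMr//.
have b1 : m.+1%:R * y <= (1 + y) ^+ m.+1.
  elim: (m.+1) => [|k ih]; first by rewrite mul0r expr0.
  rewrite exprS mulrDl mul1r -natr1 mulrDl mul1r lerD//.
  by apply: ler_peMr; [exact: ltW|apply: exprn_ege1; rewrite lerDl ltW].
have c0 : 0 <= (1 - y) ^+ m.+1 by rewrite exprn_ge0// subr_ge0.
apply: (@le_trans _ _ ((1 - y) ^+ m.+1 * (1 + y) ^+ m.+1)); first by rewrite ler_wpM2l.
rewrite -exprMn exprn_ile1//; first by rewrite mulr_ge0 ?subr_ge0// addr_ge0// ltW.
by nra.
Qed.

Lemma threshold_itv (t : R) n (w : R) : 0 <= w <= 1 -> 0 <= threshold t n w <= 1.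
Proof.
move=> /andP[w0 w1]; rewrite /threshold subr_ge0 lerBlDr lerDl.
have a1 : 0 <= 1 - w ^+ n by rewrite subr_ge0 exprn_ile1.
by rewrite exprn_ile1 ?exprn_ge0// lerBlDr lerDl exprn_ge0.
Qed.

(** By Bernoulli's inequality the value is at most m w^n with m <= t^-n + 1, that is, at most (w /
    t)^n + w^n. *)
Lemma cvg_threshold_lt (t w : R) : 0 < t < 1 -> 0 <= w <= 1 -> w < t ->
  threshold t n w @[n --> \oo] --> (0 : R).
Proof.
move=> /andP[t0 t1] /andP[w0 w1] wt.
have cg : (w / t) ^+ n + w ^+ n @[n --> \oo] --> (0 : R).
  rewrite -[X in _ --> X](addr0 0); apply: cvgD; apply: cvg_expr.
    by rewrite ger0_norm ?divr_ge0// ?(ltW t0)// ltr_pdivrMr// mul1r.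
  by rewrite ger0_norm// (lt_trans wt).
apply: (squeeze_cvgr _ (cvg_cst 0) cg); apply: nearW => n.
have /(threshold_itv t n)/andP[-> _] : 0 <= w <= 1 by rewrite w0 w1.
rewrite /threshold lerBlDr -lerBlDl.
have y01 : 0 <= w ^+ n <= 1 by rewrite exprn_ge0// exprn_ile1.
apply: le_trans (bernoulli _ _ y01).
rewrite lerB// -natr1 mulrDl mul1r lerD2r exprMn mulrC ler_wpM2l ?exprn_ge0//.
have tn0 : 0 <= t ^- n by rewrite invr_ge0 exprn_ge0// ltW.
by rewrite exprVn truncn_le.
Qed.

(** Since m > t^-n, [expr_1B_le] bounds the distance to 1 by (m w^n)^-1 <= (t / w)^n. *)
Lemma cvg_threshold_gt (t w : R) : 0 < t < 1 -> w <= 1 -> t < w ->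
  threshold t n w @[n --> \oo] --> (1 : R).
Proof.
move=> /andP[t0 t1] w1 tw; have w0 : 0 < w by exact: lt_trans tw.
have cg : 1 - (t / w) ^+ n @[n --> \oo] --> (1 : R).
  rewrite -[X in _ --> X](subr0 1); apply: cvgB; first exact: cvg_cst.
  apply: cvg_expr.
  by rewrite ger0_norm ?divr_ge0 ?(ltW t0) ?(ltW w0)// ltr_pdivrMr// mul1r.
apply: (squeeze_cvgr _ cg (cvg_cst (1 : R))); apply: nearW => n.
have /(threshold_itv t n)/andP[_ ->] : 0 <= w <= 1 by rewrite w1 ltW.
rewrite andbT /threshold lerD2l lerN2.
have wn0 : 0 < w ^+ n by rewrite exprn_gt0.
have y01 : 0 < w ^+ n <= 1 by rewrite wn0 exprn_ile1// ltW.
apply: le_trans (expr_1B_le _ _ y01) _.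
have tn0 : 0 < t ^- n by rewrite invr_gt0 exprn_gt0.
rewrite exprMn exprVn invfM ler_wpM2r ?invr_ge0 ?(ltW wn0)//.
rewrite -[leRHS]invrK lef_pV2 ?posrE ?ltr0n//.
exact/ltW/truncnS_gt.
Qed.

End Threshold.

Section Completeness.
Context {R : realType}.
Implicit Types h : R -> R.
Local Notation mu := (@lebesgue_measure R).

(** For y = 2 pi x - pi t the hypothesis reads 0 < x < t, and that of [cos_lt_arc] reads t < x <
    1. *)
Lemma cos_gt_arc (t y : R) : 0 < t < 1 -> `|y| < pi * t -> cos (pi * t) < cos y.
Proof.
move=> /andP[t0 t1] yt; rewrite -(cos_norm y).
have pt : pi * t <= pi by rewrite ler_piMr ?pi_ge0// ltW.
have y0 : 0 <= `|y| by exact: normr_ge0.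
by rewrite ltr_cos// in_itv/=; apply/andP; split=> //; lra.
Qed.

Lemma cos_lt_arc (t y : R) : 0 < t < 1 -> pi * t < y < 2 * pi - pi * t ->
  cos y < cos (pi * t).
Proof.
move=> /andP[t0 t1].
have pt0 : 0 < pi * t by rewrite mulr_gt0// pi_gt0.
have pt : pi * t <= pi by rewrite ler_piMr ?pi_ge0// ltW.
wlog ypi : y / y <= pi.
  move=> H /andP[y1 y2]; have [|ypi] := leP y pi; first by move=> /H; apply; rewrite y1.
  have -> : cos y = cos (2 * pi - y).
    by rewrite -[RHS]cosN opprB -(cosD2pi (y - 2 * pi)); congr cos; rewrite -mulr_natl; ring.
  by apply: H; lra.
move=> /andP[y1 y2].
by rewrite ltr_cos// in_itv/=; apply/andP; split=> //; lra.
Qed.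

(* With [w = (1 + cos (2 pi x - pi t)) / 2], the set [w > w 0] is the arc from 0 to [t]; its indicator
   is the bounded limit of the trigonometric polynomials [threshold (w 0) n \o w]. *)
Lemma Rintegral_prefix_eq0 h : integrable01 h ->
  (forall b n, int01 (fun x => h x * trig b n x) = 0) ->
  forall t, 0 < t < 1 -> \int[mu]_(x in `[0, t]) h x = 0.
Proof.
move=> ih h0 t t01; have /andP[t0 t1] := t01.
pose w x : R := 2^-1 + 2^-1 * (cos (pi * t) * trig false 1 x + sin (pi * t) * trig true 1 x).
have wE x : w x = (1 + cos (2 * pi * x - pi * t)) / 2.
  by rewrite /w /trig mulr1 cosB; field.
have tw : trigpoly w.
  apply: (trigpolyD (fun=> _)); first exact: trigpoly_cst.
  by apply: trigpolyZ; apply: trigpolyD; exact/trigpolyZ/trigpoly_trig.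
have w01 x : 0 <= w x <= 1.
  by rewrite wE; have := cos_geN1 (2 * pi * x - pi * t); have := cos_le1 (2 * pi * x - pi * t); lra.
pose th : R := (1 + cos (pi * t)) / 2.
have pi0 : 0 < pi :> R := pi_gt0 R.
have th01 : 0 < th < 1.
  have : cos (pi * t) < cos 0 by apply: cos_gt_arc; rewrite ?t01// normr0 mulr_gt0.
  have : cos pi < cos (pi * t).
    have pt0 : 0 < pi * t by rewrite mulr_gt0.
    have pt : pi * t < pi by rewrite gtr_pMr.
    by rewrite ltr_cos// in_itv/=; apply/andP; split=> //; lra.
  by rewrite cos0 cospi /th; lra.
pose P n x := threshold th n (w x).
have tP n : trigpoly (P n).
  have -> : P n = fun x => 1 + (-1) * (1 + (-1) * w x ^+ n) ^+ (Num.truncn (th ^- n)).+1.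
    by apply/funext => x; rewrite /P /threshold !mulN1r.
  apply: (trigpolyD (fun=> 1)); first exact: trigpoly_cst.
  apply/trigpolyZ/trigpolyX/(trigpolyD (fun=> 1)); first exact: trigpoly_cst.
  exact/trigpolyZ/trigpolyX.
have mh : measurable_fun (`[0%R, 1%R]%classic : set R) h by case/integrableP : ih => /measurable_EFinP.
have mP n : measurable_fun (`[0%R, 1%R]%classic : set R) (P n).
  by apply: measurable_funTS; case: (bounded_borel_trigpoly _ (tP n)).
have [||||||_ _ +] := @dominated_convergence _ _ _ mu `[0%R, 1%R] _
    (fun n x => (h x * P n x)%:E) (EFin \o (h \_ `[0%R, t])) (fun x => `|h x|%:E).
- exact: measurable_itv.
- by move=> n; apply/measurable_EFinP; apply: measurable_funM; [exact: mh|exact: mP].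
- apply/measurable_EFinP; apply/measurable_restrict => //.
  by apply: measurable_funS mh => //; exact: subIsetl.
(* At these three points [w] equals [th], where neither limit of [threshold] applies. *)
- exists [set 0; t; 1]; split.
  + by do 2?apply: measurableU; exact: measurable_set1.
  + by apply: countable_lebesgue_measure0; apply: finite_set_countable.
  move=> x; apply: contra_notP => /= /not_orP[/not_orP[/eqP x0 /eqP xt] /eqP x1].
  rewrite in_itv/= => /andP[x0' x1'].
  have {x0 x0'} x0 : 0 < x by rewrite lt_neqAle eq_sym x0.
  have {x1 x1'} x1 : x < 1 by rewrite lt_neqAle x1.
  apply/cvg_EFin; first exact: nearW.
  have [{}xt|xt'] := ltP x t.
    rewrite /= patchE mem_set/=; last by rewrite in_itv/= !ltW.
    rewrite -[X in _ --> X]mulr1; apply: cvgM; first exact: cvg_cst.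
    apply: cvg_threshold_gt => //; first by case/andP : (w01 x).
    rewrite wE /th ltr_pM2r ?invr_gt0// ltrD2l; apply: cos_gt_arc => //.
    rewrite ltr_norml; apply/andP; split; last by nra.
    rewrite ltrBrDr addNr; by rewrite !mulr_gt0.
  have {xt xt'} xt : t < x by rewrite lt_neqAle eq_sym xt.
  rewrite /= patchE memNset/=; last by rewrite in_itv/= [x <= t]leNgt xt andbF.
  rewrite -[X in _ --> X](mulr0 (h x)); apply: cvgM; first exact: cvg_cst.
  apply: cvg_threshold_lt => //.
  rewrite wE /th ltr_pM2r ?invr_gt0// ltrD2l; apply: cos_lt_arc => //.
  by apply/andP; split; nra.
- exact: (integrable_abse ih).
- apply: aeW => x n xD /=; rewrite lee_fin normrM ler_piMr//.
  by have /andP[p0 p1] := threshold_itv th n _ (w01 x); rewrite ger0_norm.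
rewrite (_ : (fun n => _) = cst 0%E); last first.
  apply/funext => n /=; have := int01_trigpoly_eq0 h (P n) ih h0 (tP n).
  rewrite /int01 /Rintegral => H; rewrite -[LHS]fineK; first by rewrite H.
  by apply: integrable_fin_num => //; exact/integrable01M/bounded_borel_trigpoly.
move=> /(cvg_unique (@ereal_hausdorff R) (cvg_cst 0%E)) /esym H.
rewrite /Rintegral -[RHS]/(fine 0%E) -H -restrict_EFin -integral_mkcondr; congr (fine (integral _ _ _)).
apply/seteqP; split => x /=; rewrite !in_itv/=; last by case.
by move=> /andP[x0 xt]; split; rewrite x0 ?xt ?(le_trans xt (ltW t1)).
Qed.

(** The primitive of [h] vanishes on (0, 1) by [Rintegral_prefix_eq0], while its derivative is [h]
    almost everywhere by Lebesgue differentiation. *)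
Lemma trig_complete h : measurable_fun setT h -> integrable01 h ->
  (forall b n, int01 (fun x => h x * trig b n x) = 0) ->
  {ae mu, forall x, `[0%R, 1%R]%classic x -> h x = 0}.
Proof.
move=> mh ih h0; pose f := h \_ `[0%R, 1%R].
have iT : mu.-integrable setT (EFin \o f).
  by rewrite -restrict_EFin; apply/(integrable_mkcond _ _).1.
have := @FTC1 R f (BLeft 0).
have iy y : mu.-integrable [set` Interval (BLeft 0) (BRight y)] (EFin \o f).
  exact: integrableS iT.
move=> /(_ iy (integrable_locally (measurable_itv _) ih)) [].
move=> N [mN N0 NP].
exists (N `|` [set 0; 1]); split.
- by do 2?apply: measurableU => //; exact: measurable_set1.
- apply: null_set_setU => //; first by apply: measurableU; exact: measurable_set1.
  by apply: countable_lebesgue_measure0; apply: finite_set_countable.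
move=> x /= hx; have [|xN] := pselect (N x); first by left.
right; apply: contrapT => /not_orP[/eqP x0 /eqP x1]; apply: hx.
rewrite in_itv/= => /andP[x0' x1'].
have {x0 x0'} x0 : 0 < x by rewrite lt_neqAle eq_sym x0.
have {x1 x1'} x1 : x < 1 by rewrite lt_neqAle x1.
have : derivable (fun y : R => \int[mu]_(t in `[0, y]) f t) x 1 /\
    (fun y : R => \int[mu]_(t in `[0, y]) f t)^`()%classic x = f x.
  by apply: contrapT => K; apply: xN; apply: NP => H; apply/K/H.
move=> [_].
rewrite [in f x]/f patchE mem_set/=; last by rewrite in_itv/= !ltW.
move=> <-; rewrite derive1E (@near_eq_derive _ _ _ _ (cst 0)) ?derive_cst//.
near=> y.
have y0 : 0 < y by near: y; exact: lt_nbhsr.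
have y1 : y < 1 by near: y; exact: lt_nbhsl.
rewrite -[RHS](@Rintegral_prefix_eq0 _ ih h0 y) ?y0//.
rewrite /Rintegral; congr fine; apply: eq_integral => z.
rewrite inE/= in_itv/= => /andP[z0 zy].
by rewrite /f patchE mem_set//= in_itv/= z0 (le_trans zy (ltW y1)).
Unshelve. all: end_near. Qed.

End Completeness.

(** * Affine changes of variables *)

Section Affine.
Context {R : realType}.
Local Notation mu := (@lebesgue_measure R).

Definition affine (a b : R) : measurableTypeR R -> measurableTypeR R :=
  fun x => a * x + b.

Lemma measurable_affine (a b : R) : measurable_fun setT (affine a b).
Proof.
apply: (@continuous_measurable_fun R) => x.
by apply: cvgD; [exact: mulrl_continuous | exact: cvg_cst].
Qed.

HB.instance Definition _ (a b : R) :=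
  isMeasurableFun.Build _ _ _ _ _ (measurable_affine a b).

Lemma affine_preimage_itv (a b c d : R) (x y : bool) : 0 < a ->
  affine a b @^-1` [set` Interval (BSide x c) (BSide y d)] =
  [set` Interval (BSide x ((c - b) / a)) (BSide y ((d - b) / a))].
Proof.
move=> a0; apply/seteqP; split => z /=; rewrite !in_itv /affine/=;
  by case: x; case: y => /=;
     rewrite ?ler_pdivrMr ?ler_pdivlMr ?ltr_pdivrMr ?ltr_pdivlMr// ?lerBlDr ?lerBrDr ?ltrBlDr ?ltrBrDr [z * a]mulrC.
Qed.

(** The pushforward of [mu] scaled by [a] agrees with [mu] on half-open intervals, and these
    determine the measure. *)
Lemma lebesgue_measure_affine (a b : R) (A : set R) : 0 < a -> measurable A ->
  mu (affine a b @^-1` A) = ((a^-1)%:E * mu A)%E.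
Proof.
move=> a0 mA.
have a0' : 0 <= a by exact: ltW.
have H (m : measurable_fun setT (affine a b)) :
    mu A = mscale (NngNum a0') (pushforward mu (affine a b)) A.
  apply: lebesgue_measure_unique => //= _ [[c d]] _ <-.
  rewrite /mscale/= /pushforward affine_preimage_itv//= !lebesgue_measure_itv/=.
  rewrite !lte_fin ltr_pM2r ?invr_gt0// ltrD2r.
  case: ifP => _; last by rewrite mule0.
  rewrite -!EFinB -EFinM; congr EFin; field.
  by rewrite gt_eqF.
rewrite (H (measurable_affine a b)); last exact: measurable_affine.
rewrite /mscale/= /pushforward [RHS]muleA -EFinM mulVf ?gt_eqF// mul1e //.
Qed.

Lemma ge0_integral_affine (a b : R) (D : set R) (f : R -> \bar R) : 0 < a ->
  measurable D -> measurable_fun setT f -> (forall x, 0 <= f x)%E ->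
  (\int[mu]_(x in affine a b @^-1` D) f (a * x + b)%R =
   (a^-1)%:E * \int[mu]_(x in D) f x)%E.
Proof.
move=> a0 mD mf f0.
have mfD : measurable_fun (D : set (measurableTypeR R)) f by exact: measurable_funS mf.
have iv0 : 0 <= a^-1 by rewrite invr_ge0 ltW.
rewrite -(@ge0_integral_mscale _ _ _ mu D mD (NngNum iv0))//.
rewrite -[LHS](@ge0_integral_pushforward _ _ _ _ R (affine a b) (measurable_affine a b) mu D f)//.
apply: eq_measure_integral => //= A mA _.
by rewrite /pushforward lebesgue_measure_affine.
Qed.

Lemma negligible_affine (a b : R) (A : set R) : 0 < a -> measurable A ->
  mu A = 0%E -> mu (affine a b @^-1` A) = 0%E.
Proof. by move=> a0 mA A0; rewrite lebesgue_measure_affine// A0 mule0. Qed.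

(** Substituting y = k x gives k^-1 times the integral over [0, k], which splits into [k] unit
    slices that are equal by periodicity. Half-open intervals keep the slices disjoint. *)
Lemma sqint_dilate (u : R -> R) (k : nat) : (0 < k)%N -> measurable_fun setT u ->
  (forall x, u (x + 1) = u x) ->
  sqint mu `[0%R, 1%R] (fun x => u (k%:R * x)) = sqint mu `[0%R, 1%R] u.
Proof.
move=> k0 mu_ pu.
pose f x := ((u x) ^+ 2)%:E.
have mf : measurable_fun setT f by exact: measurable_sqr.
have f0 x : (0 <= f x)%E by rewrite lee_fin sqr_ge0.
have per n x : f (x + n%:R) = f x.
  elim: n x => [|n ih] x; first by rewrite addr0.
  by rewrite -natr1 addrA /f pu; exact: ih.
have E (a b : R) (g : R -> \bar R) : measurable_fun setT g -> (\int[mu]_(x in `[a, b]) g x = \int[mu]_(x in `[a, b[) g x)%E.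
  by move=> mg; apply: esym; apply: integral_itv_bndo_bndc; exact: measurable_funTS.
have slice (n : nat) : (\int[mu]_(x in `[n%:R, n.+1%:R[) f x = \int[mu]_(x in `[0%R, 1%R[) f x)%E.
  have := @ge0_integral_affine 1 n%:R `[n%:R, n.+1%:R[%classic f ltr01 (measurable_itv _) mf f0.
  rewrite affine_preimage_itv// !invr1 mul1e !mulr1 subrr -natr1 addrAC subrr add0r => <-.
  by apply: eq_integral => x _; rewrite mul1r per.
have tot (n : nat) : (\int[mu]_(x in `[0%R, n%:R[) f x = (n%:R : R)%:E * \int[mu]_(x in `[0%R, 1%R[) f x)%E.
  elim: n => [|n ih]; first by rewrite set_itvco0 integral_set0 mul0e.
  rewrite (@itv_bndbnd_setU _ _ (BLeft 0) (BLeft n%:R) (BLeft n.+1%:R)) ?bnd_simp ?ler_nat//.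
  rewrite ge0_integral_setU//; last 2 first.
  - exact: measurable_funTS.
  - rewrite disj_set2E; apply/eqP/seteqP; split => x //= []; rewrite !in_itv/=.
    by move=> /andP[_ xn] /andP[nx _]; move: xn; rewrite ltNge nx.
  by rewrite ih slice -[n.+1%:R]natr1 EFinD ge0_muleDl ?lee_fin// mul1e.
have muk : measurable_fun setT (fun x : R => u (k%:R * x)).
  have mk : measurable_fun setT (fun x : R => k%:R * x) by apply: continuous_measurable_fun; exact: mulrl_continuous.
  exact: (measurableT_comp mu_ mk).
rewrite /sqint !E; [|exact: mf|exact: measurable_sqr].
have k0' : 0 < k%:R :> R by rewrite ltr0n.
have := @ge0_integral_affine k%:R 0 `[0%R, k%:R[%classic f k0' (measurable_itv _) mf f0.
rewrite affine_preimage_itv// !subr0 mul0r divff ?gt_eqF// tot muleA -EFinM mulVf ?gt_eqF// mul1e => <-.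
by apply: eq_integral => x _; rewrite addr0.
Qed.

End Affine.

(** * Borel representatives *)

Section BorelRepresentative.
Context {R : realType}.
Local Notation mu := (@lebesgue_measure R).
Local Notation leb := (@completed_lebesgue_measure R).

Lemma borel_lebesgue_measurable_set (A : set R) :
  measurable A -> measurable (A : set (lebesgueR R)).
Proof. exact: sub_caratheodory. Qed.

(** The identity, seen as a map from the larger sigma-algebra to the Borel one; pushing [leb]
    forward along it gives [mu] back, which transfers integrals of Borel functions. *)
Definition to_borel : lebesgueR R -> measurableTypeR R := idfun.

Lemma measurable_to_borel : measurable_fun setT to_borel.
Proof. by move=> _ A mA; rewrite setTI; exact: borel_lebesgue_measurable_set. Qed.

HB.instance Definition _ := isMeasurableFun.Build _ _ _ _ _ measurable_to_borel.

(* Used with [g] Borel and [N] a Borel null set: statements about the completed measure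
   are then read off the Borel function [g]. *)
Definition equal_off (T : Type) (N : set R) (f g : R -> T) :=
  [/\ measurable N, mu N = 0%E & forall x, ~ N x -> f x = g x].

Lemma equal_off_refl (T : Type) (f : R -> T) : equal_off T set0 f f.
Proof. by split => //; exact: measure0. Qed.

Lemma equal_off_ae (T : Type) (N : set R) (f g : R -> T) (D : set (lebesgueR R)) :
  equal_off T N f g -> f = g %[ae leb in D].
Proof.
move=> [mN N0 fg]; exists N; split => //; first exact: borel_lebesgue_measurable_set.
move=> x /= nH; apply: contrapT => Nx; apply: nH => _; exact: fg.
Qed.

Lemma emeasurable_equal_off (N : set R) (F G : R -> \bar R) : equal_off _ N F G ->
  measurable_fun setT G -> measurable_fun setT (F : lebesgueR R -> \bar R).
Proof.
move=> FG mG; apply: (@ae_measurable_fun _ _ _ leb _ _ G).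
- exact: completed_lebesgue_measure_is_complete.
- by apply: ae_eq_sym; exact: equal_off_ae FG.
- exact: (measurableT_comp mG measurable_to_borel).
Qed.

Lemma lebesgue_measurable_equal_off (N : set R) (f g : R -> R) :
  equal_off _ N f g -> measurable_fun setT g -> lebesgue_measurable f.
Proof.
move=> [mN N0 fg] mg; apply/measurable_EFinP.
apply: (@emeasurable_equal_off N _ (EFin \o g)); last exact/measurable_EFinP.
by split => // x Nx /=; rewrite fg.
Qed.

Lemma lebesgue_integral_equal_off (N D : set R) (F G : R -> \bar R) :
  equal_off _ N F G -> measurable D -> measurable_fun setT G ->
  (\int[leb]_(x in (D : set (lebesgueR R))) F x = \int[mu]_(x in D) G x)%E.
Proof.
move=> FG mD mG.
have mD' : measurable (D : set (lebesgueR R)) by exact: borel_lebesgue_measurable_set.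
have mG' := measurableT_comp mG measurable_to_borel.
transitivity (\int[leb]_(x in (D : set (lebesgueR R))) G x)%E.
  apply: ae_eq_integral => //.
  - by apply: measurable_funTS; exact: emeasurable_equal_off FG mG.
  - exact: measurable_funTS.
  - exact: equal_off_ae FG.
have ge0 (H : R -> \bar R) : measurable_fun setT H -> (forall x, 0 <= H x)%E ->
    (\int[leb]_(x in (D : set (lebesgueR R))) H x = \int[mu]_(x in D) H x)%E.
  move=> mH H0.
  have mHD : measurable_fun (D : set (measurableTypeR R)) H by exact: measurable_funTS.
  rewrite -[LHS](@ge0_integral_pushforward _ _ _ _ R to_borel measurable_to_borel leb D H)//.
rewrite integralE [RHS]integralE; congr (_ - _)%E.
  by apply: ge0; [exact: measurable_funepos | move=> x; exact: funepos_ge0].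
by apply: ge0; [exact: measurable_funeneg | move=> x; exact: funeneg_ge0].
Qed.

(** Take the union of all integer translates, enumerated through [unpickle]. Invariance under the
    shift allows a periodic function to be set to 0 on [N] without losing its period. *)
Lemma negligible_shifts (B : set R) : measurable B -> mu B = 0%E ->
  exists N : set R, [/\ measurable N, mu N = 0%E, B `<=` N & forall x, N (x + 1) <-> N x].
Proof.
move=> mB B0; pose z n : int := odflt 0 (unpickle n).
pose F n := affine 1 (z n)%:~R @^-1` B.
have mF n : measurable (F n).
  by rewrite -[F n]setTI; exact: (measurable_affine 1 (z n)%:~R).
exists (\bigcup_n F n); split.
- exact: bigcupT_measurable.
- apply/negligibleP; first exact: bigcupT_measurable.
  apply: negligible_bigcup => n; apply/negligibleP; first exact: mF.
  exact: negligible_affine.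
- move=> x Bx; exists (pickle (0 : int)) => //.
  by rewrite /F /z pickleK /= /affine mul1r addr0.
- move=> x; split => -[n _]; rewrite /F /affine/= mul1r => Bn.
    exists (pickle (z n + 1)) => //.
    by rewrite /F/= /affine [z (pickle _)]/z pickleK /= mul1r intrD addrCA addrC -addrA [1 + _]addrC addrA addrAC.
  exists (pickle (z n - 1)) => //.
  by rewrite /F/= /affine [z (pickle _)]/z pickleK /= mul1r intrB addrACA subrr addr0.
Qed.

(** Each set {f > q} with [q] rational is Borel up to a null set. Setting [f] to 0 on a
    shift-invariant null set that contains all these exceptions makes it Borel, because {f > r} is
    the union of {f > q} over rational q > r. *)
Lemma borel_representative (f : R -> R) : lebesgue_measurable f ->
  (forall x, f (x + 1) = f x) ->
  exists g N, [/\ equal_off _ N f g, measurable_fun setT g & forall x, g (x + 1) = g x].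
Proof.
move=> mf pf; pose q n : R := ratr (odflt 0 (unpickle n) : rat).
have /choice[X XP] n : exists X : set R * set R, [/\ measurable X.1, measurable X.2, mu X.2 = 0%E &
    [/\ X.1 `<=` f @^-1` `]q n, +oo[ & f @^-1` `]q n, +oo[ `<=` X.1 `|` X.2]].
  have : measurable (setT `&` (f : lebesgueR R -> R) @^-1` `]q n, +oo[) by exact: mf.
  rewrite setTI -[X in X _]completed_caratheodory_measurable g_sigma_completed_algebra_genE.
  move=> [X mX [N [B [mB B0 NB]] XN]]; exists (X, B); split => //; rewrite -XN; split.
    by move=> x; left.
  by apply: setUS.
have [||N [mN N0 BN NS]] := @negligible_shifts (\bigcup_n (X n).2).
- by apply: bigcupT_measurable => n; case: (XP n).
- apply/negligibleP; first by apply: bigcupT_measurable => n; case: (XP n).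
  by apply: negligible_bigcup => n; case: (XP n) => _ m2 ? _; apply/negligibleP.
exists (f \_ (~` N)), N; split.
- by split => // x Nx; rewrite patchE mem_set.
- apply/measurable_restrict => //; first exact: measurableC.
  rewrite setTI; apply: (measurability _ (RGenOInfty.measurableE R)).
  move=> _ [_ [r ->] <-].
  rewrite (_ : _ `&` _ = \bigcup_n (if r < q n then ~` N `&` (X n).1 else set0)).
    apply: bigcupT_measurable => n; case: ifP => // _.
    by apply: measurableI; [exact: measurableC | case: (XP n)].
  apply/seteqP; split => x /=.
    move=> [Nx]; rewrite in_itv/= andbT => rf.
    have [p] := rat_in_itvoo rf; rewrite in_itv/= => /andP[rp pf'].
    exists (pickle p) => //; rewrite /q pickleK /= rp; split => //.
    have [_ _ _ [_]] := XP (pickle p); rewrite /q pickleK /= => /(_ x) [].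
    + by rewrite /= in_itv/= pf'.
    + by [].
    + by move=> X2; exfalso; apply: Nx; apply: BN; exists (pickle p).
  move=> [n _]; case: ifP => // rq [Nx X1]; split => //.
  have [_ _ _ [+ _]] := XP n => /(_ _ X1) /=.
  by rewrite !in_itv/= !andbT; exact: lt_trans.
- move=> x; rewrite !patchE pf; case: (pselect (N x)) => Nx.
    by rewrite !memNset// => -[]; apply/NS.
  by rewrite !mem_set//= => /NS.
Qed.

End BorelRepresentative.

(** * Sums over divisors *)

Section NonnegSums.
Context {R : realDomainType}.

Lemma ler_sum_mem (I : eqType) (s : seq I) (x : I) (F : I -> R) :
  (forall i, 0 <= F i) -> x \in s -> F x <= \sum_(i <- s) F i.
Proof.
move=> F0; elim: s => // y s ih; rewrite inE big_cons => /predU1P[->|xs].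
  by rewrite lerDl sumr_ge0.
by rewrite (le_trans (ih xs))// lerDr.
Qed.

Lemma sum_eq_le1 (I : eqType) (s : seq I) (x : I) : uniq s ->
  \sum_(i <- s) (x == i)%:R <= (x \in s)%:R :> R.
Proof.
elim: s => [|y s ih] /=; first by rewrite big_nil.
move=> /andP[ys /ih {}ih]; rewrite big_cons inE.
have [xy|xy] /= := eqVneq x y; last by rewrite add0r.
by move: ih; rewrite xy (negbTE ys) => ih; rewrite -[leRHS]addr0 lerD2l.
Qed.

End NonnegSums.

Section PowerSums.
Context {R : realType}.

Lemma natpowR_gt0 (k : nat) (r : R) : (0 < k)%N -> 0 < k%:R `^ r.
Proof. by move=> k0; rewrite powR_gt0// ltr0n. Qed.

(** Cauchy condensation: the 2^m terms with 2^m <= j < 2^(m+1) add up to at most q^m, and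
    [q < 1]. *)
Lemma sum_powR_bounded (s : R) : 1 < s ->
  exists2 Z, 0 <= Z & forall N, \sum_(1 <= j < N.+1) j%:R `^ (- s) <= Z.
Proof.
move=> s1; pose q : R := 2 `^ (1 - s).
have q0 : 0 < q by rewrite powR_gt0.
have q1 : q < 1 
  by rewrite /q /powR pnatr_eq0/= expR_lt1 pmulr_llt0 ?subr_lt0// ln_gt0// ltr1n.
have dyadic m : \sum_(1 <= j < 2 ^ m) j%:R `^ (- s) <= \sum_(i < m) q ^+ i.
  elim: m => [|m ih]; first by rewrite expn0 big_geq// big_ord0.
  rewrite big_ord_recr/= (@big_cat_nat _ _ _ (2 ^ m))/= ?expn_gt0// ?leq_exp2l//.
  rewrite lerD//.
  apply: (@le_trans _ _ (\sum_(2 ^ m <= j < 2 ^ m.+1) (2 ^ m)%:R `^ (- s))).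
    apply: ler_sum_nat => j /andP[mj _].
    rewrite !powRN lef_pV2 ?posrE ?natpowR_gt0 ?expn_gt0// ?(leq_trans _ mj) ?expn_gt0//.
    by rewrite ge0_ler_powR ?nnegrE// ?ler_nat// (le_trans ler01)// ltW.
  rewrite sumr_const_nat expnS mul2n -addnn addnK -[leLHS]mulr_natl.
  rewrite le_eqVlt; apply/orP; left; apply/eqP.
  have -> : (2 ^ m)%:R = 2 `^ m%:R :> R by rewrite powR_mulrn// natrX.
  rewrite -powRrM -powRD; last by rewrite pnatr_eq0 implybT.
  by rewrite -[q ^+ m]powR_mulrn ?(ltW q0)// /q -powRrM; congr powR; ring.
exists (1 - q)^-1; first by rewrite invr_ge0 subr_ge0 ltW.
move=> N; apply: le_trans (le_trans (dyadic N.+1) _).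
  rewrite [leRHS](@big_cat_nat _ _ _ N.+1)//=.
    by rewrite lerDl sumr_ge0// => j _; rewrite powR_ge0.
  by rewrite ltnW// ltn_expl.
rewrite -[leRHS]mul1r ler_pdivlMr ?subr_gt0// mulrC.
have -> : (1 - q) * \sum_(i < N.+1) q ^+ i = 1 - q ^+ N.+1.
  by rewrite -(opprB q 1) mulNr -subrX1 opprB.
by rewrite lerBlDr lerDl exprn_ge0// ltW.
Qed.

(* With [e = gcd(i, k)], [i = e i'] and [i'] divides [j = i' j'']; the three exponents are then
   [1 - 2 alpha + delta], [- 2 alpha] and [- 1 - delta]. *)
Lemma divisor_pairs_bound (alpha delta : R) : 2^-1 < alpha -> 0 < delta ->
  exists2 Z, 0 <= Z & forall k P : nat, (0 < k)%N ->
  \sum_(1 <= j < P.+1) \sum_(1 <= i < P.+1) (i %| j * k)%N%:R *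
    (i%:R `^ (1 - 2 * alpha + delta) * j%:R `^ (- (1 + delta))) <=
  Z * sigma (1 - 2 * alpha + delta) k.
Proof.
move=> halpha hdelta; set r := 1 - 2 * alpha + delta.
have [Z1 Z10 hZ1] := @sum_powR_bounded (2 * alpha) ltac:(lra).
have [Z2 Z20 hZ2] := @sum_powR_bounded (1 + delta) ltac:(lra).
exists (Z1 * Z2); first exact: mulr_ge0.
move=> k P k0; pose I := index_iota 1 P.+1.
have I1 i : i \in I -> (0 < i)%N by rewrite mem_index_iota => /andP[].
pose w (e i' j'' : nat) := e%:R `^ r * (i'%:R `^ (- (2 * alpha)) * j''%:R `^ (- (1 + delta))).
have w0 e i' j'' : 0 <= w e i' j'' by rewrite !mulr_ge0 ?powR_ge0.
pose t (i j : nat) := i%:R `^ r * j%:R `^ (- (1 + delta)) : R.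
(* Each admissible pair is represented by at least one triple (e, i', j''). After the sums are
   exchanged, a triple determines i = e i' and j = i' j'', so it is counted at most once. *)
have le1 j i : j \in I -> i \in I -> (i %| j * k)%N%:R * t i j <=
    \sum_(e <- divisors k) \sum_(i' <- I) \sum_(j'' <- I)
       ((e * i' == i)%N && (i' * j'' == j)%N)%:R * w e i' j''.
  move=> jI iI; have i0 := I1 _ iI; have j0 := I1 _ jI.
  have [idjk|_] := boolP (i %| j * k)%N; last first.
    by rewrite mul0r !sumr_ge0// => e _; apply: sumr_ge0 => i' _; apply: sumr_ge0 => j'' _; rewrite mulr_ge0.
  pose e := gcdn i k; pose i' := (i %/ e)%N.
  have e0 : (0 < e)%N by rewrite gcdn_gt0 i0.
  have eiE : (e * i' = i)%N by rewrite mulnC divnK// dvdn_gcdl.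
  have i'0 : (0 < i')%N by move: i0; rewrite -eiE muln_gt0 => /andP[].
  (* Cancelling [e] in i | j k leaves i' | j (k / e), and i' is coprime to k / e. *)
  have i'j : (i' %| j)%N.
    have cop : coprime i' (k %/ e).
      by rewrite /coprime -(eqn_pmul2l e0) muln_gcdr eiE [(e * (k %/ e))%N]mulnC divnK ?dvdn_gcdr// muln1.
    rewrite -(Gauss_dvdl _ cop) -(dvdn_pmul2l e0) eiE mulnCA.
    by rewrite [(e * (k %/ e))%N]mulnC divnK ?dvdn_gcdr.
  pose j'' := (j %/ i')%N.
  have ijE : (i' * j'' = j)%N by rewrite mulnC divnK.
  have j''0 : (0 < j'')%N by move: j0; rewrite -ijE muln_gt0 => /andP[].
  have i'I : i' \in I.
    move: iI; rewrite !mem_index_iota i'0 i0 /= !ltnS => /(leq_trans _); apply.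
    by rewrite -eiE leq_pmull.
  have j''I : j'' \in I.
    move: jI; rewrite !mem_index_iota j''0 j0 /= !ltnS => /(leq_trans _); apply.
    by rewrite -ijE leq_pmull.
  have eD : e \in divisors k by rewrite -dvdn_divisors// dvdn_gcdr.
  have tE : t i j = w e i' j''.
    rewrite /t /w -eiE -ijE !natrM !powRM// mulrACA -!mulrA; congr (_ * _).
    rewrite !mulrA; congr (_ * _).
    rewrite -powRD; last by rewrite pnatr_eq0 -lt0n i'0 implybT.
    by congr powR; rewrite /r; ring.
  rewrite mul1r tE.
  have T0 e1 i1 j1 : 0 <= ((e1 * i1 == i)%N && (i1 * j1 == j)%N)%:R * w e1 i1 j1.
    by rewrite mulr_ge0.
  apply: le_trans (@ler_sum_mem R _ _ e _ _ eD); last first.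
    by move=> e1; apply: sumr_ge0 => i1 _; apply: sumr_ge0.
  apply: le_trans (@ler_sum_mem R _ _ i' _ _ i'I); last first.
    by move=> i1; apply: sumr_ge0.
  apply: le_trans (@ler_sum_mem R _ _ j'' _ _ j''I) => //.
  by rewrite eiE ijE !eqxx mul1r.
apply: (@le_trans _ _ (\sum_(j <- I) \sum_(i <- I) \sum_(e <- divisors k) \sum_(i' <- I)
    \sum_(j'' <- I) ((e * i' == i)%N && (i' * j'' == j)%N)%:R * w e i' j'')).
  rewrite big_seq [leRHS]big_seq; apply: ler_sum => j jI.
  by rewrite big_seq [leRHS]big_seq; apply: ler_sum => i iI; exact: le1.
have -> : \sum_(j <- I) \sum_(i <- I) \sum_(e <- divisors k) \sum_(i' <- I)
    \sum_(j'' <- I) ((e * i' == i)%N && (i' * j'' == j)%N)%:R * w e i' j'' =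
  \sum_(e <- divisors k) \sum_(i' <- I) \sum_(j'' <- I)
    w e i' j'' * ((\sum_(i <- I) (e * i' == i)%N%:R) * (\sum_(j <- I) (i' * j'' == j)%N%:R)).
  under eq_bigr => j _.
    rewrite exchange_big/=; under eq_bigr => e _.
      rewrite exchange_big/=; under eq_bigr => i' _ do rewrite exchange_big/=.
      over.
    over.
  rewrite exchange_big/=; apply: eq_bigr => e _.
  rewrite exchange_big/=; apply: eq_bigr => i' _.
  rewrite exchange_big/=; apply: eq_bigr => j'' _.
  rewrite big_distrlr/= [in RHS]exchange_big/= mulr_sumr; apply: eq_bigr => j _.
  by rewrite mulr_sumr; apply: eq_bigr => i _; rewrite -natrM mulnb mulrC.
rewrite /sigma mulr_sumr; apply: ler_sum => e _.
apply: (@le_trans _ _ (\sum_(i' <- I) \sum_(j'' <- I) w e i' j'')).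
  apply: ler_sum => i' _; apply: ler_sum => j'' _.
  have S1 n : 0 <= (\sum_(i <- I) (n == i)%:R : R) <= 1.
    apply/andP; split; first exact: sumr_ge0.
    apply: le_trans (sum_eq_le1 _ _ _ (iota_uniq _ _)) _.
    by case: (_ \in _).
  have /andP[a0 a1] := S1 (e * i')%N; have /andP[b0 b1] := S1 (i' * j'')%N.
  by rewrite ler_piMr// mulr_ile1.
have -> : \sum_(i' <- I) \sum_(j'' <- I) w e i' j'' =
    e%:R `^ r * ((\sum_(i' <- I) i'%:R `^ (- (2 * alpha))) *
                 (\sum_(j'' <- I) j''%:R `^ (- (1 + delta)))).
  by rewrite big_distrlr/= mulr_sumr; apply: eq_bigr => i' _; rewrite mulr_sumr.
rewrite mulrC ler_wpM2r ?powR_ge0//.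
by apply: ler_pM; [exact: sumr_ge0|exact: sumr_ge0|exact: hZ1|exact: hZ2].
Qed.

(* Schur test with weight [(i / j) ^ (1 - alpha + delta)]. *)
Lemma divisor_form_bound (alpha delta : R) : 2^-1 < alpha -> 0 < delta ->
  exists2 Z, 0 <= Z & forall (d : nat -> R) (K : seq nat) (P : nat),
  uniq K -> (forall k, k \in K -> (0 < k)%N) ->
  \sum_(k <- K) \sum_(l <- K) \sum_(1 <= j < P.+1) \sum_(1 <= i < P.+1)
    (j * k == i * l)%N%:R * (`|d k| * `|d l| * (i%:R `^ (- alpha) * j%:R `^ (- alpha))) <=
  Z * \sum_(k <- K) d k ^+ 2 * sigma (1 - 2 * alpha + delta) k.
Proof.
move=> halpha hdelta; set r := 1 - 2 * alpha + delta.
have [Z Z0 hZ] := divisor_pairs_bound alpha delta halpha hdelta.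
exists Z => // d K P uK K0; pose I := index_iota 1 P.+1.
(* This is (i j)^-alpha times the Schur weight (i / j)^(1 - alpha + delta), so that t i j * t j i =
   (i j)^(-2 alpha). *)
pose t (i j : nat) := i%:R `^ r * j%:R `^ (- (1 + delta)) : R.
have t0 i j : 0 <= t i j by rewrite mulr_ge0 ?powR_ge0.
pose A k l j i := (j * k == i * l)%N%:R * (d k ^+ 2 * t i j).
have A0 k l j i : 0 <= A k l j i by apply: mulr_ge0 => //; apply: mulr_ge0 => //; exact: sqr_ge0.
have amgm k l j i : i \in I -> j \in I ->
    (j * k == i * l)%N%:R * (`|d k| * `|d l| * (i%:R `^ (- alpha) * j%:R `^ (- alpha))) <=
    2^-1 * (A k l j i + A l k i j).
  rewrite !mem_index_iota => /andP[i0 _] /andP[j0 _].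
  have Es : (i * l == j * k)%N = (j * k == i * l)%N by rewrite eq_sym.
  rewrite /A Es -mulrDr [leRHS]mulrCA; apply: ler_wpM2l => //.
  pose x := `|d k| * Num.sqrt (t i j); pose y := `|d l| * Num.sqrt (t j i).
  have -> : d k ^+ 2 * t i j = x ^+ 2 by rewrite exprMn sqr_sqrtr// real_normK ?num_real.
  have -> : d l ^+ 2 * t j i = y ^+ 2 by rewrite exprMn sqr_sqrtr// real_normK ?num_real.
  have -> : `|d k| * `|d l| * (i%:R `^ (- alpha) * j%:R `^ (- alpha)) = x * y.
    have pE (n : nat) : (0 < n)%N -> n%:R `^ r * n%:R `^ (- (1 + delta)) = (n%:R `^ (- alpha)) ^+ 2.
      move=> n0; rewrite -powRD; last by rewrite pnatr_eq0 -lt0n n0 implybT.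
      by rewrite -[RHS]powR_mulrn ?powR_ge0// -powRrM; congr powR; rewrite /r; ring.
    rewrite /x /y [RHS]mulrACA -sqrtrM//; congr (_ * _).
    have -> : t i j * t j i = (i%:R `^ (- alpha) * j%:R `^ (- alpha)) ^+ 2.
      by rewrite exprMn -!pE// /t; ring.
    by rewrite sqrtr_sqr ger0_norm// mulr_ge0 ?powR_ge0.
  by have := sqr_ge0 (x - y); nra.
have sumA : \sum_(k <- K) \sum_(l <- K) \sum_(j <- I) \sum_(i <- I) A k l j i <=
    Z * \sum_(k <- K) d k ^+ 2 * sigma r k.
  rewrite mulr_sumr big_seq [leRHS]big_seq; apply: ler_sum => k kK.
  rewrite mulrCA; apply: (@le_trans _ _ (d k ^+ 2 * \sum_(j <- I) \sum_(i <- I) (i %| j * k)%N%:R * t i j)).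
    rewrite exchange_big mulr_sumr; apply: ler_sum => j _.
    rewrite exchange_big mulr_sumr big_seq [leRHS]big_seq; apply: ler_sum => i iI.
    have i0 : (0 < i)%N by move: iI; rewrite mem_index_iota => /andP[].
    rewrite /A -mulr_suml mulrCA ler_wpM2l ?sqr_ge0// ler_wpM2r//.
    (* For given k, j, i the equation j k = i l has a solution only if i | j k, and then [l] is the
       quotient; the sum over [l] is thus at most the divisibility indicator. *)
    have [/dvdnP[q qE]|nd] := boolP (i %| j * k)%N; last first.
      rewrite big1// => l _; case: eqP => // E.
      by case/negP: nd; rewrite E dvdn_mulr.
    rewrite qE (eq_bigr (fun l => (q == l)%:R)).
      by apply: le_trans (sum_eq_le1 _ _ _ uK) _; case: (_ \in _).
    by move=> l _; rewrite mulnC eqn_pmul2l.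
  by rewrite ler_wpM2l ?sqr_ge0// hZ// K0.
apply: le_trans sumA.
apply: (@le_trans _ _ (2^-1 * ((\sum_(k <- K) \sum_(l <- K) \sum_(j <- I) \sum_(i <- I) A k l j i) +
   \sum_(k <- K) \sum_(l <- K) \sum_(j <- I) \sum_(i <- I) A l k i j))).
  rewrite -big_split mulr_sumr; apply: ler_sum => k _.
  rewrite -big_split mulr_sumr; apply: ler_sum => l _.
  rewrite -big_split mulr_sumr big_seq [leRHS]big_seq; apply: ler_sum => j jI.
  rewrite -big_split mulr_sumr big_seq [leRHS]big_seq; apply: ler_sum => i iI.
  exact: amgm.
have -> : \sum_(k <- K) \sum_(l <- K) \sum_(j <- I) \sum_(i <- I) A l k i j =
    \sum_(k <- K) \sum_(l <- K) \sum_(j <- I) \sum_(i <- I) A k l j i.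
  rewrite exchange_big; apply: eq_bigr => k _; apply: eq_bigr => l _.
  by rewrite exchange_big.
by lra.
Qed.

End PowerSums.

(** * Trigonometric sums and their dilations *)

Section SquareIntegrable01.
Context {R : realType}.
Local Notation mu := (@lebesgue_measure R).
Local Notation sq01 := (sqint mu `[0%R, 1%R]).

Lemma sq01_integrable (u : R -> R) : measurable_fun setT u -> (sq01 u < +oo)%E ->
  integrable01 u /\ integrable01 (fun x => u x ^+ 2).
Proof.
move=> mu_ u2; have i2 : integrable01 (fun x => u x ^+ 2).
  apply/integrableP; split; first exact: measurable_sqr.
  under eq_integral do rewrite /= ger0_norm ?sqr_ge0//.
  exact: u2.
split => //; have iD : integrable01 (fun x => 1 + u x ^+ 2).
  by apply: integrable01D => //; exact: integrable01_cst.
apply: (le_integrable _ _ _ iD) => //.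
  by apply/measurable_EFinP; exact: measurable_funTS.
move=> x _ /=; rewrite lee_fin [leRHS]ger0_norm ?addr_ge0 ?sqr_ge0//.
rewrite -[X in _ + X]real_normK ?num_real//.
by have := sqr_ge0 (`|u x| - 1); have := normr_ge0 (u x); nra.
Qed.

Lemma int01_cst (c : R) : int01 (fun=> c) = c.
Proof.
rewrite /int01 Rintegral_cst//= lebesgue_measure_itv/= lte_fin ltr01.
by rewrite oppr0 adde0 mulr1.
Qed.

(** The pointwise bound |u| <= e / 2 + u^2 / (2 e) takes the place of the Cauchy-Schwarz
    inequality. *)
Lemma le_int01_trig (u : R -> R) (e : R) b n : 0 < e -> measurable_fun setT u ->
  (sq01 u <= (e ^+ 2)%:E)%E -> `|int01 (fun x => u x * trig b n x)| <= e.
Proof.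
move=> e0 mu_ u2; have [iu iu2] : integrable01 u /\ integrable01 (fun x => u x ^+ 2).
  by apply: sq01_integrable => //; rewrite (le_lt_trans u2)// ltry.
have iut := integrable01M u _ iu (bounded_borel_trig b n).
have iB : integrable01 (fun x => 2^-1 * e + (2 * e)^-1 * u x ^+ 2).
  by apply: integrable01D; [exact: integrable01_cst | exact: integrable01Z].
apply: le_trans (le_normr_Rintegral _ iut) _ => //.
apply: (@le_trans _ _ (int01 (fun x => 2^-1 * e + (2 * e)^-1 * u x ^+ 2))).
  apply: le_Rintegral => //; first exact: (integrable_norm iut).
  move=> x _; rewrite normrM.
  apply: (@le_trans _ _ `|u x|); first by rewrite ler_piMr// trig_le1.
  rewrite -(ler_pM2l (_ : 0 < 2 * e)); last by rewrite mulr_gt0.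
  rewrite mulrDr [X in _ + X]mulrA divff ?mul1r; last by rewrite gt_eqF// mulr_gt0.
  rewrite -[u x ^+ 2]real_normK ?num_real//.
  by have := sqr_ge0 (`|u x| - e); nra.
rewrite int01D; [|exact: integrable01_cst|exact: integrable01Z].
rewrite [X in _ + X]int01Z//.
have H : int01 (fun x => u x ^+ 2) <= e ^+ 2 by rewrite -lee_fin -sqint01E.
rewrite int01_cst.
have H' : (2 * e)^-1 * int01 (fun x => u x ^+ 2) <= (2 * e)^-1 * e ^+ 2.
  by rewrite ler_pM2l// invr_gt0 mulr_gt0.
have E : (2 * e)^-1 * e ^+ 2 = 2^-1 * e by field; rewrite gt_eqF.
by rewrite E in H'; lra.
Qed.

Lemma sq01_eq_ae (u v : R -> R) : measurable_fun setT u -> measurable_fun setT v ->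
  {ae mu, forall x, `[0%R, 1%R]%classic x -> u x = v x} -> sq01 u = sq01 v.
Proof.
move=> mu_ mv uv; apply: ge0_ae_eq_integral => //.
- exact: measurable_sqr.
- exact: measurable_sqr.
- by move=> x _; rewrite lee_fin sqr_ge0.
- by move=> x _; rewrite lee_fin sqr_ge0.
case: uv => N [mN N0 H]; exists N; split => // x /= nx; apply: H => /= hx.
by apply: nx => Dx; rewrite hx.
Qed.

Lemma int01_mul_sum (I J : Type) (s : seq I) (r : seq J) (u : I -> R -> R) (v : J -> R -> R) :
  (forall i, bounded_borel (u i)) -> (forall j, bounded_borel (v j)) ->
  int01 (fun x => (\sum_(i <- s) u i x) * (\sum_(j <- r) v j x)) =
  \sum_(i <- s) \sum_(j <- r) int01 (fun x => u i x * v j x).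
Proof.
move=> bu bv.
have -> : (fun x => (\sum_(i <- s) u i x) * (\sum_(j <- r) v j x)) =
    fun x => \sum_(i <- s) \sum_(j <- r) u i x * v j x.
  by apply/funext => x; rewrite big_distrlr.
rewrite int01_sum; last first.
  by move=> i; apply: integrable01_sum => j; apply: bounded_borel_integrable01; exact: bounded_borelM.
apply: eq_bigr => i _; rewrite int01_sum// => j.
by apply: bounded_borel_integrable01; exact: bounded_borelM.
Qed.

End SquareIntegrable01.

Section TrigonometricSums.
Context {R : realType}.
Local Notation mu := (@lebesgue_measure R).
Local Notation sq01 := (sqint mu `[0%R, 1%R]).
Implicit Types (a : bool -> nat -> R) (c : nat -> R).

Definition trigterm a (j : nat) (x : R) : R := \sum_(b : bool) a b j * trig b j x.

Definition trigsum a (P : nat) (x : R) : R := \sum_(1 <= j < P.+1) trigterm a j x.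

Lemma bounded_borelZ (c : R) (u : R -> R) :
  bounded_borel u -> bounded_borel (fun x => c * u x).
Proof. by apply: bounded_borelM; exact: bounded_borel_cst. Qed.

Lemma bounded_borel_trigterm a j k : bounded_borel (fun x => trigterm a j (k%:R * x)).
Proof.
apply: bounded_borel_sum => b; apply: bounded_borelZ.
by under eq_fun do rewrite trig_mul; exact: bounded_borel_trig.
Qed.

Lemma bounded_borel_trigterm1 a j : bounded_borel (trigterm a j).
Proof. by apply: bounded_borel_sum => b; apply: bounded_borelZ; exact: bounded_borel_trig. Qed.

Lemma bounded_borel_trigsum_dilate a P k : bounded_borel (fun x => trigsum a P (k%:R * x)).
Proof. by apply: bounded_borel_sum => j; exact: bounded_borel_trigterm. Qed.

Lemma bounded_borel_trigsum a P : bounded_borel (trigsum a P).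
Proof. by apply: bounded_borel_sum => j; exact: bounded_borel_trigterm1. Qed.

Lemma trigsum1 a P x : trigsum a P (x + 1) = trigsum a P x.
Proof. by apply: eq_bigr => j _; apply: eq_bigr => b _; rewrite trig1. Qed.

Lemma int01_trigterm_dilate a j k i l : (0 < j * k)%N ->
  int01 (fun x => trigterm a j (k%:R * x) * trigterm a i (l%:R * x)) =
  (j * k == i * l)%N%:R * (2^-1 * \sum_(b : bool) a b j * a b i).
Proof.
move=> jk0; rewrite int01_mul_sum; last 2 first.
- by move=> b; apply: bounded_borelZ; under eq_fun do rewrite trig_mul; exact: bounded_borel_trig.
- by move=> b; apply: bounded_borelZ; under eq_fun do rewrite trig_mul; exact: bounded_borel_trig.
have E b b' : int01 (fun x => a b j * trig b j (k%:R * x) * (a b' i * trig b' i (l%:R * x))) =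
    a b j * a b' i * (2^-1 * ((b == b') && (j * k == i * l)%N)%:R).
  rewrite -(trig_orthogonal b _ b' _ jk0) -int01Z.
    by congr int01; apply/funext => x; rewrite !trig_mul mulrACA.
  apply: bounded_borel_integrable01.
  by apply: bounded_borelM; exact: bounded_borel_trig.
under eq_bigr do under eq_bigr do rewrite E.
by rewrite !big_bool/=; case: (_ == _); rewrite /= ?mulr0 ?mul0r; ring.
Qed.

Lemma int01_trigsum_dilate a P k l : (0 < k)%N ->
  int01 (fun x => trigsum a P (k%:R * x) * trigsum a P (l%:R * x)) =
  \sum_(1 <= j < P.+1) \sum_(1 <= i < P.+1)
    (j * k == i * l)%N%:R * (2^-1 * \sum_(b : bool) a b j * a b i).
Proof.
move=> k0; rewrite int01_mul_sum; last 2 first.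
- by move=> j; exact: bounded_borel_trigterm.
- by move=> j; exact: bounded_borel_trigterm.
apply: eq_big_nat => j /andP[j0 _]; apply: eq_bigr => i _.
by rewrite int01_trigterm_dilate// muln_gt0 j0.
Qed.

Definition dilated_trigsum a c (K : seq nat) P (x : R) : R :=
  \sum_(k <- K) c k * trigsum a P (k%:R * x).

Lemma bounded_borel_dilated_trigsum a c K P : bounded_borel (dilated_trigsum a c K P).
Proof.
by apply: bounded_borel_sum => k; apply: bounded_borelZ; exact: bounded_borel_trigsum_dilate.
Qed.

Lemma sq01_dilated_trigsum a c K P : (forall k, k \in K -> (0 < k)%N) ->
  sq01 (dilated_trigsum a c K P) =
  (\sum_(k <- K) \sum_(l <- K) \sum_(1 <= j < P.+1) \sum_(1 <= i < P.+1)
    (j * k == i * l)%N%:R * (c k * c l * (2^-1 * \sum_(b : bool) a b j * a b i)))%:E.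
Proof.
move=> K0; rewrite sqint01E; last first.
  by apply/bounded_borel_integrable01/bounded_borelX/bounded_borel_dilated_trigsum.
congr EFin; under [X in int01 X]eq_fun do rewrite expr2.
rewrite int01_mul_sum; last 2 first.
- by move=> k; apply: bounded_borelZ; exact: bounded_borel_trigsum_dilate.
- by move=> k; apply: bounded_borelZ; exact: bounded_borel_trigsum_dilate.
rewrite big_seq [RHS]big_seq; apply: eq_bigr => k /K0 k0; apply: eq_bigr => l _.
have -> : (fun x => c k * trigsum a P (k%:R * x) * (c l * trigsum a P (l%:R * x))) =
    fun x => c k * c l * (trigsum a P (k%:R * x) * trigsum a P (l%:R * x)).
  by apply/funext => x; rewrite mulrACA.
rewrite int01Z; last first.
  by apply/bounded_borel_integrable01/bounded_borelM; exact: bounded_borel_trigsum_dilate.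
rewrite int01_trigsum_dilate// mulr_sumr; apply: eq_bigr => j _.
by rewrite mulr_sumr; apply: eq_bigr => i _; rewrite mulrCA.
Qed.

Lemma sq01_trigsumB a P Q : (Q <= P)%N ->
  sq01 (fun x => trigsum a P x - trigsum a Q x) =
  (2^-1 * \sum_(Q.+1 <= j < P.+1) \sum_(b : bool) a b j ^+ 2)%:E.
Proof.
move=> QP.
have -> : (fun x => trigsum a P x - trigsum a Q x) =
    fun x => \sum_(Q.+1 <= j < P.+1) trigterm a j (1%:R * x).
  apply/funext => x; rewrite /trigsum (@big_cat_nat _ _ _ Q.+1)//= [X in X - _]addrC addrK.
  by apply: eq_bigr => j _; rewrite mul1r.
rewrite sqint01E; last first.
  apply/bounded_borel_integrable01/bounded_borelX/bounded_borel_sum => j.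
  exact: bounded_borel_trigterm.
congr EFin; under [X in int01 X]eq_fun do rewrite expr2.
rewrite int01_mul_sum; last 2 first.
- by move=> j; exact: bounded_borel_trigterm.
- by move=> j; exact: bounded_borel_trigterm.
rewrite mulr_sumr big_seq [RHS]big_seq; apply: eq_bigr => j jI.
have j0 : (0 < j)%N by move: jI; rewrite mem_index_iota => /andP[/(leq_ltn_trans _)->].
rewrite (bigD1_seq j) ?iota_uniq//= big1; last first.
  move=> i ij; rewrite int01_trigterm_dilate ?muln1//.
  by rewrite eq_sym (negbTE ij) mul0r.
by rewrite int01_trigterm_dilate ?muln1// eqxx mul1r addr0; congr (_ * _); apply: eq_bigr.
Qed.

Lemma int01_trigsum_trig a P b n :
  int01 (fun x => trigsum a P x * trig b n x) =
  if (0 < n <= P)%N then 2^-1 * a b n else 0.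
Proof.
have E j : (0 < j)%N -> int01 (fun x => trigterm a j x * trig b n x) = (j == n)%:R * (2^-1 * a b j).
  move=> j0.
  have -> : (fun x => trigterm a j x * trig b n x) =
      fun x => \sum_(b' : bool) a b' j * (trig b' j x * trig b n x).
    by apply/funext => x; rewrite mulr_suml; apply: eq_bigr => b' _; rewrite mulrA.
  rewrite int01_sum; last first.
    move=> b'; apply: integrable01Z; apply: bounded_borel_integrable01.
    by apply: bounded_borelM; exact: bounded_borel_trig.
  have E' b' : int01 (fun x => a b' j * (trig b' j x * trig b n x)) =
      a b' j * (2^-1 * ((b' == b) && (j == n))%:R).
    rewrite int01Z ?trig_orthogonal//; apply: bounded_borel_integrable01.
    by apply: bounded_borelM; exact: bounded_borel_trig.
  under eq_bigr do rewrite E'.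
  by rewrite big_bool/= {E'}; case: b; case: (j == n); rewrite /= ?mulr0 ?mul0r; ring.
have -> : (fun x => trigsum a P x * trig b n x) =
    fun x => \sum_(1 <= j < P.+1) trigterm a j x * trig b n x.
  by apply/funext => x; rewrite mulr_suml.
rewrite int01_sum; last first.
  move=> j; apply: bounded_borel_integrable01.
  by apply: bounded_borelM; [exact: bounded_borel_trigterm1 | exact: bounded_borel_trig].
rewrite (eq_big_nat _ _ (F2 := fun j => (j == n)%:R * (2^-1 * a b j))); last first.
  by move=> j /andP[j0 _]; exact: E.
case: ifPn => nP.
  rewrite (bigD1_seq n) ?iota_uniq ?mem_index_iota ?ltnS//= big1 ?addr0 ?eqxx ?mul1r//.
  by move=> j /negbTE ->; rewrite mul0r.
rewrite big_seq big1// => j; rewrite mem_index_iota ltnS => jI.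
by case: eqP => [jn|_]; rewrite ?mul0r//; move: nP; rewrite -jn jI.
Qed.

End TrigonometricSums.

(** * Fourier series *)

(** Once a partial sum is within [e] of the supremum, no later block can exceed [e]. *)
Lemma nonneg_tail {R : realType} (u : nat -> R) (Z : R) : (forall j, 0 <= u j) ->
  (forall N, \sum_(1 <= j < N.+1) u j <= Z) ->
  forall e, 0 < e -> exists N, forall P Q, (N <= Q <= P)%N -> \sum_(Q.+1 <= j < P.+1) u j <= e.
Proof.
move=> u0 uZ e e0; pose E := range (fun N => \sum_(1 <= j < N.+1) u j).
have sE : has_sup E.
  by split; [exists (\sum_(1 <= j < 1) u j), 0%N | exists Z => _ [N _ <-]].
have [_ [N _ <-] HN] := sup_adherent e0 sE.
exists N => P Q /andP[NQ QP].
have : \sum_(1 <= j < P.+1) u j <= sup E by apply: sup_upper_bound => //; exists P.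
rewrite (@big_cat_nat _ _ _ N.+1)//=; last by rewrite ltnS (leq_trans NQ).
rewrite [X in _ + X](@big_cat_nat _ _ _ Q.+1)//=.
have : 0 <= \sum_(N.+1 <= j < Q.+1) u j by apply: sumr_ge0.
by lra.
Qed.

Section FourierSeries.
Context {R : realType}.
Local Notation mu := (@lebesgue_measure R).
Local Notation sq01 := (sqint mu `[0%R, 1%R]).
Context (a : bool -> nat -> R) (alpha C : R) (halpha : 2^-1 < alpha).
Context (aC : forall b j, (0 < j)%N -> `|a b j| <= C * j%:R `^ (- alpha)).

Lemma sq01C (u v : R -> R) : sq01 (fun x => u x - v x) = sq01 (fun x => v x - u x).
Proof. by apply: eq_integral => x _; rewrite -sqrrN opprB. Qed.

Lemma coef_sqr_le b j : (0 < j)%N -> a b j ^+ 2 <= C ^+ 2 * j%:R `^ (- (2 * alpha)).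
Proof.
move=> j0; rewrite -real_normK ?num_real//.
have -> : C ^+ 2 * j%:R `^ (- (2 * alpha)) = (C * j%:R `^ (- alpha)) ^+ 2.
  rewrite exprMn; congr (_ * _).
  by rewrite -[RHS]powR_mulrn ?powR_ge0// -powRrM; congr powR; ring.
rewrite lerXn2r ?nnegrE ?aC//.
exact: le_trans (aC b j j0).
Qed.

Lemma trigsum_cauchy (e : R) : 0 < e -> exists N, forall m n, (N <= m)%N -> (N <= n)%N ->
  (sq01 (fun x => trigsum a m x - trigsum a n x)%R <= e%:E)%E.
Proof.
move=> e0; have alpha1 : 1 < 2 * alpha by move: halpha; lra.
have [Z Z0 HZ] := @sum_powR_bounded R (2 * alpha) alpha1.
pose u j : R := C ^+ 2 * j%:R `^ (- (2 * alpha)).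
have u0 j : 0 <= u j by rewrite mulr_ge0 ?sqr_ge0 ?powR_ge0.
have uZ N : \sum_(1 <= j < N.+1) u j <= C ^+ 2 * Z.
  by rewrite -mulr_sumr ler_wpM2l ?sqr_ge0.
have [N HN] := nonneg_tail u _ u0 uZ e e0.
exists N => m n; wlog nm : m n / (n <= m)%N.
  move=> H Nm Nn; have [|/ltnW] := leqP n m; first by move=> /H; apply.
  by move=> /H; rewrite sq01C; apply.
move=> Nm Nn; rewrite sq01_trigsumB// lee_fin.
apply: (@le_trans _ _ (2^-1 * \sum_(n.+1 <= j < m.+1) (u j + u j))).
  rewrite ler_wpM2l// ler_sum_nat// => j /andP[nj _].
  by rewrite big_bool lerD// coef_sqr_le// (leq_trans _ nj).
by rewrite big_split/=; have := HN m n; rewrite Nn nm => /(_ isT); lra.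
Qed.

(** Riesz-Fischer: the coefficients are square summable because 2 alpha > 1. The function [G] serves
    both to identify a given [g] with its Fourier series and as the counterexample. *)
Lemma trig_series_exists : exists G : R -> R, [/\ measurable_fun setT G,
  forall x, G (x + 1) = G x, (sq01 G < +oo)%E &
  forall e, 0 < e -> exists N, forall P, (N <= P)%N ->
    (sq01 (fun x => trigsum a P x - G x)%R <= e%:E)%E].
Proof.
have mS n : measurable_fun setT (trigsum a n) by case: (bounded_borel_trigsum a n).
have [Phi [mPhi HPhi]] := @sqint_complete _ _ R mu `[0%R, 1%R] (trigsum a) (measurable_itv _) mS trigsum_cauchy.
pose G (x : R) := Phi ((trigsum a) ^~ x); exists G.
have mG : measurable_fun setT G by exact: mPhi.
have {}HPhi e : 0 < e -> exists N, forall P, (N <= P)%N ->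
    (sq01 (fun x => trigsum a P x - G x)%R <= e%:E)%E by exact: HPhi.
split => //.
- move=> x; congr Phi; apply/funext => n; exact: trigsum1.
- have [N /(_ N (leqnn N)) HN] := HPhi 1 ltr01.
  have -> : G = (fun x => trigsum a N x + (-1) * (trigsum a N x - G x)).
    by apply/funext => x; rewrite mulN1r opprB addrC subrK.
  have mB : measurable_fun setT (fun x => trigsum a N x - G x) by exact: measurable_funB.
  have mB' : measurable_fun setT (fun x => (-1) * (trigsum a N x - G x)) by exact: measurable_funM.
  apply: le_lt_trans (@sqintD_le _ _ _ mu `[0%R, 1%R] (measurable_itv _) _ _ (mS N) mB') _.
  rewrite sqintZ//; apply: lte_add_pinfty; apply: lte_mul_pinfty => //.
    rewrite sqint01E ?ltry//.
    exact/bounded_borel_integrable01/bounded_borelX/bounded_borel_trigsum.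
  by rewrite sqrrN expr1n mul1e (le_lt_trans HN)// ltry.
Qed.

(** Integration against [trig b n] is continuous for the square norm, and [trigsum a P] already has
    the exact coefficient as soon as [n <= P]. *)
Lemma int01_trig_series (G : R -> R) : measurable_fun setT G -> (sq01 G < +oo)%E ->
  (forall e, 0 < e -> exists N, forall P, (N <= P)%N ->
    (sq01 (fun x => trigsum a P x - G x)%R <= e%:E)%E) ->
  forall b n, int01 (fun x => G x * trig b n x) = if (0 < n)%N then 2^-1 * a b n else 0.
Proof.
move=> mG G2 HG b n; apply/eqP; rewrite eq_sym -subr_eq0 -normr_le0; apply/ler_addgt0Pr => e e0.
rewrite add0r; have [N HN] := HG (e ^+ 2) (exprn_gt0 _ e0).
have [iG _] := sq01_integrable _ mG G2.
pose P := maxn N n.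
have := HN P (leq_maxl _ _) => /(le_int01_trig _ _ b n e0).
have -> : (fun x => (trigsum a P x - G x) * trig b n x) =
   fun x => trigsum a P x * trig b n x - G x * trig b n x.
  by apply/funext => x; rewrite mulrBl.
rewrite int01B; first last.
- exact: integrable01M (bounded_borel_trig b n).
- apply: bounded_borel_integrable01; apply: bounded_borelM; [exact: bounded_borel_trigsum | exact: bounded_borel_trig].
rewrite int01_trigsum_trig leq_maxr andbT; apply.
by apply: measurable_funB => //; case: (bounded_borel_trigsum a P).
Qed.

(** The series converges to some [G] with the same coefficients as [g]; completeness of the
    trigonometric system forces [g = G] almost everywhere. *)
Lemma fourier_series_cvg (g : R -> R) : measurable_fun setT g -> (sq01 g < +oo)%E ->
  (forall b n, int01 (fun x => g x * trig b n x) = if (0 < n)%N then 2^-1 * a b n else 0) ->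
  forall e, 0 < e -> exists N, forall P, (N <= P)%N ->
    (sq01 (fun x => trigsum a P x - g x)%R <= e%:E)%E.
Proof.
move=> mg g2 hg e e0; have [G [mG _ G2 HG]] := trig_series_exists.
have [N HN] := HG e e0; exists N => P NP.
rewrite (_ : sq01 _ = sq01 (fun x => trigsum a P x - G x)); first exact: HN.
have mP : measurable_fun setT (trigsum a P) by case: (bounded_borel_trigsum a P).
have [ig _] := sq01_integrable _ mg g2; have [iG _] := sq01_integrable _ mG G2.
have ih : integrable01 (fun x => g x - G x).
  have -> : (fun x => g x - G x) = fun x => g x + (-1) * G x by apply/funext => x; rewrite mulN1r.
  by apply: integrable01D => //; exact: integrable01Z.
have [|N0 [mN0 N00 HN0]] := trig_complete _ (measurable_funB mg mG) ih.
  move=> b n.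
  have -> : (fun x => (g x - G x) * trig b n x) = fun x => g x * trig b n x - G x * trig b n x.
    by apply/funext => x; rewrite mulrBl.
  rewrite int01B; [|exact: integrable01M (bounded_borel_trig b n)..].
  by rewrite hg (int01_trig_series _ mG G2 HG) subrr.
apply: sq01_eq_ae; [exact: measurable_funB | exact: measurable_funB |].
exists N0; split => // x /= nx; apply: HN0 => /= hx; apply: nx => Dx.
by rewrite (subr0_eq (hx Dx)).
Qed.

End FourierSeries.

(** * The norm of L^2(0, 1) and Fourier coefficients *)

Section L2norm.
Context {R : realType}.
Local Notation mu := (@lebesgue_measure R).
Local Notation leb := (@completed_lebesgue_measure R).
Local Notation sq01 := (sqint mu `[0%R, 1%R]).
Local Notation I01 := (`[0%R, 1%R]%classic : set (lebesgueR R)).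
Local Notation J01 := (`]0%R, 1%R[%classic : set (lebesgueR R)).

Lemma sqint_equal_off (N : set R) (u v : R -> R) : equal_off _ N u v ->
  measurable_fun setT v -> sqint leb I01 u = sq01 v.
Proof.
move=> [mN N0 uv] mv; apply: (@lebesgue_integral_equal_off _ N).
- by split => // x Nx; rewrite uv.
- exact: measurable_itv.
- exact: measurable_sqr.
Qed.

Lemma L2normE (u : R -> R) : lebesgue_measurable u ->
  L2norm u = (sqint leb I01 u `^ 2^-1)%E.
Proof.
move=> mu_; rewrite /L2norm unlock; congr (_ `^ _)%E.
pose F (x : lebesgueR R) := ((u x) ^+ 2)%:E.
have mI : measurable I01 by apply: borel_lebesgue_measurable_set; exact: measurable_itv.
have mJ : measurable J01 by apply: borel_lebesgue_measurable_set; exact: measurable_itv.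
have mF : measurable_fun setT F by exact: measurable_sqr.
transitivity (\int[leb]_x (F \_ J01) x)%E.
  apply: eq_integral => x _ /=; rewrite powR_mulrn//.
  rewrite !patchE; case: ifP => _; rewrite real_normK ?num_real//.
  by rewrite expr0n.
rewrite /sqint [RHS]integral_mkcond; apply: ge0_ae_eq_integral => //.
- by apply/(measurable_restrictT _ _).1 => //; exact: measurable_funTS mF.
- by apply/(measurable_restrictT _ _).1 => //; exact: measurable_funTS mF.
- by move=> x _; rewrite patchE; case: ifP => // _; rewrite lee_fin sqr_ge0.
- by move=> x _; rewrite patchE; case: ifP => // _; rewrite lee_fin sqr_ge0.
(* [L2norm] uses the open interval and [sqint] the closed one; they differ by the two endpoints. *)
apply: (@equal_off_ae _ _ [set 0; 1]); split.
- by apply: measurableU; exact: measurable_set1.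
- by apply: countable_lebesgue_measure0; apply: finite_set_countable.
move=> x /= /not_orP[/eqP x0 /eqP x1]; rewrite !patchE.
have -> // : (x \in J01) = (x \in I01).
apply/idP/idP; rewrite !inE/= !in_itv/= => /andP[a b]; first by rewrite !ltW.
by rewrite !lt_neqAle a b x1 eq_sym x0.
Qed.

Lemma le_L2norm (u : R -> R) (e : R) : 0 < e -> lebesgue_measurable u ->
  (sqint leb I01 u <= (e ^+ 2)%:E)%E -> (L2norm u <= e%:E)%E.
Proof.
move=> e0 mu_ ue; rewrite L2normE//.
have -> : e%:E = ((e ^+ 2)%:E `^ 2^-1)%E.
  by rewrite poweR_EFin powR12_sqrt ?sqr_ge0// sqrtr_sqr gtr0_norm.
apply: gt0_ler_poweR => //; rewrite in_itv/= ?leey ?andbT.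
  exact: sqint_ge0.
by rewrite lee_fin sqr_ge0.
Qed.

Lemma lt_sqint_L2norm (u : R -> R) : lebesgue_measurable u ->
  (L2norm u < +oo)%E -> (sqint leb I01 u < +oo)%E.
Proof. by move=> mu_; rewrite L2normE// => /lty_poweRy; apply; rewrite invr_eq0 pnatr_eq0. Qed.

Lemma sqint_le_L2norm (u : R -> R) (e : R) : 0 < e -> lebesgue_measurable u ->
  (L2norm u <= e%:E)%E -> (sqint leb I01 u <= (e ^+ 2)%:E)%E.
Proof.
move=> e0 mu_; rewrite L2normE// => ue.
have s0 : (0 <= sqint leb I01 u)%E by exact: sqint_ge0.
have -> : sqint leb I01 u = ((sqint leb I01 u `^ 2^-1) `^ 2)%E.
  by rewrite -poweRrM mulVf ?pnatr_eq0// poweRe1.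
have -> : (e ^+ 2)%:E = (e%:E `^ 2)%E by rewrite poweR_EFin powR_mulrn// ltW.
apply: gt0_ler_poweR => //; rewrite in_itv/= ?leey ?andbT.
  exact: poweR_ge0.
by rewrite lee_fin ltW.
Qed.

End L2norm.

Section FourierCoefficients.
Context {R : realType}.
Local Notation leb := (@completed_lebesgue_measure R).

Definition fourier_coef (f : R -> R) (b : bool) (n : nat) : R :=
  if b then sin_coef f n else cos_coef f n.

Lemma fourier_coefE (N : set R) (f g : R -> R) b n : equal_off _ N f g ->
  measurable_fun setT g -> fourier_coef f b n = 2 * int01 (fun x => g x * trig b n x).
Proof.
move=> [mN N0 fg] mg.
have -> : fourier_coef f b n =
    2 * \int[leb]_(x in (`[0%R, 1%R]%classic : set (lebesgueR R))) (f x * trig b n x).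
  by case: b.
congr (2 * fine _); apply: (@lebesgue_integral_equal_off _ N).
- by split => // x Nx; rewrite fg.
- exact: measurable_itv.
- by apply/measurable_EFinP; apply: measurable_funM => //; exact: measurable_trig.
Qed.

Lemma bigO_powR_bound (u : nat -> R) (alpha : R) :
  (u : nat -> R^o) =O_\oo (fun j => j%:R `^ (- alpha) : R^o) ->
  exists2 C, 0 <= C & forall j, (0 < j)%N -> `|u j| <= C * j%:R `^ (- alpha).
Proof.
move=> /eqO_exP[k k0 [N _ HN]].
(* The asymptotic constant [k] holds from [N] on; the sum of ratios absorbs the finitely many
   earlier indices. *)
exists (k + \sum_(0 <= j < N) `|u j| / j%:R `^ (- alpha)).
  by apply: addr_ge0; [exact: ltW|apply: sumr_ge0 => j _; rewrite divr_ge0 ?powR_ge0].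
move=> j j0; have p0 : 0 < j%:R `^ (- alpha) by exact: natpowR_gt0.
have S0 : 0 <= \sum_(0 <= j < N) `|u j| / j%:R `^ (- alpha).
  by apply: sumr_ge0 => i _; rewrite divr_ge0 ?powR_ge0.
rewrite mulrDl; have [Nj|jN] := leqP N j.
  have := HN j Nj; rewrite /= [X in _ * X]ger0_norm ?powR_ge0// => H.
  by rewrite (le_trans H)// lerDl mulr_ge0// ltW.
apply: (@le_trans _ _ ((\sum_(0 <= j < N) `|u j| / j%:R `^ (- alpha)) * j%:R `^ (- alpha))).
  rewrite -ler_pdivrMr//.
  apply: (@ler_sum_mem _ _ _ j (fun j => `|u j| / j%:R `^ (- alpha))).
    by move=> i; rewrite divr_ge0 ?powR_ge0.
  by rewrite mem_index_iota.
by rewrite lerDr mulr_ge0// ltW.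
Qed.

End FourierCoefficients.

(** * Convergence *)

Section Convergence.
Context {R : realType}.
Local Notation mu := (@lebesgue_measure R).
Local Notation sq01 := (sqint mu `[0%R, 1%R]).

Lemma measurable_dilate (g : R -> R) (k : R) :
  measurable_fun setT g -> measurable_fun setT (fun x : R => g (k * x)).
Proof.
move=> mg.
have mk : measurable_fun setT (fun x : R => k * x).
  by apply: continuous_measurable_fun; exact: mulrl_continuous.
exact: (measurableT_comp mg mk).
Qed.

Definition dilated_sum_on (c : nat -> R) (g : R -> R) (K : seq nat) (x : R) : R :=
  \sum_(k <- K) c k * g (k%:R * x).

Lemma measurable_dilated_sum_on c (g : R -> R) K :
  measurable_fun setT g -> measurable_fun setT (dilated_sum_on c g K).
Proof.
move=> mg; apply: measurable_sum => k; apply: measurable_funM => //.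
exact: measurable_dilate.
Qed.

(** No arithmetic enters here, so this applies to truncation errors, of which only periodicity and
    smallness are known. *)
Lemma sq01_dilated_sum_on_le c (g : R -> R) K : (forall k, k \in K -> (0 < k)%N) ->
  measurable_fun setT g -> (forall x, g (x + 1) = g x) ->
  (sq01 (dilated_sum_on c g K) <=
   ((2 ^+ size K) * \sum_(k <- K) (c k) ^+ 2)%R%:E * sq01 g)%E.
Proof.
move=> K0 mg pg.
have mT k : measurable_fun setT (fun x : R => c k * g (k%:R * x)).
  by apply: measurable_funM => //; exact: measurable_dilate.
apply: le_trans (@sqint_sum_le _ _ _ mu `[0%R, 1%R] (measurable_itv _) _ K _ mT) _.
rewrite EFinM -muleA; apply: lee_wpmul2l; first by rewrite lee_fin exprn_ge0.
rewrite -sumEFin ge0_sume_distrl; last by move=> k _; rewrite lee_fin sqr_ge0.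
rewrite big_seq [leRHS]big_seq; apply: lee_sum => k kK.
rewrite sqintZ//; last exact: measurable_dilate.
by rewrite sqint_dilate// K0.
Qed.

Lemma dilated_sum_onB_trigsum a c (g : R -> R) K P x :
  dilated_sum_on c g K x = dilated_trigsum a c K P x +
    dilated_sum_on c (fun x => g x - trigsum a P x) K x.
Proof.
rewrite /dilated_trigsum /dilated_sum_on -big_split/=; apply: eq_bigr => k _.
by rewrite -mulrDr addrC subrK.
Qed.

Lemma sq01_dilated_trigsum_le (a : bool -> nat -> R) (alpha delta C : R) :
  2^-1 < alpha -> 0 < delta ->
  (forall b j, (0 < j)%N -> `|a b j| <= C * j%:R `^ (- alpha)) ->
  exists2 Z, 0 <= Z & forall c K P, uniq K -> (forall k, k \in K -> (0 < k)%N) ->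
    (sq01 (dilated_trigsum a c K P) <=
     (Z * \sum_(k <- K) c k ^+ 2 * sigma (1 - 2 * alpha + delta) k)%:E)%E.
Proof.
move=> halpha hdelta aC.
have [Z Z0 HZ] := divisor_form_bound alpha delta halpha hdelta.
exists (C ^+ 2 * Z); first by rewrite mulr_ge0// sqr_ge0.
move=> c K P uK K0; rewrite sq01_dilated_trigsum// lee_fin -mulrA.
apply: le_trans (ler_wpM2l (sqr_ge0 C) (HZ c K P uK K0)).
rewrite !mulr_sumr; apply: ler_sum => k _.
rewrite !mulr_sumr; apply: ler_sum => l _.
rewrite !mulr_sumr; apply: ler_sum_nat => j /andP[j0 _].
rewrite !mulr_sumr; apply: ler_sum_nat => i /andP[i0 _].
rewrite [leRHS]mulrCA ler_wpM2l//.
apply: le_trans (ler_norm _) _; rewrite 2!normrM [leRHS]mulrCA ler_wpM2l ?mulr_ge0//.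
have ab b : `|a b j * a b i| <= C ^+ 2 * (i%:R `^ (- alpha) * j%:R `^ (- alpha)).
  rewrite normrM (_ : C ^+ 2 * _ = (C * j%:R `^ (- alpha)) * (C * i%:R `^ (- alpha))); last by ring.
  by rewrite ler_pM// aC.
rewrite normrM ger0_norm ?invr_ge0// big_bool/=.
have := ler_normD (a true j * a true i) (a false j * a false i).
by have := ab true; have := ab false; lra.
Qed.

(** With [K] fixed, the Fourier series is truncated so late that the error costs at most [e]. The
    bound for the truncated part does not depend on the order of truncation, so [e] can tend to
    0. *)
Lemma sq01_dilated_sum_on_bound (g : R -> R) (alpha delta C : R) :
  2^-1 < alpha -> 0 < delta ->
  measurable_fun setT g -> (forall x, g (x + 1) = g x) -> (sq01 g < +oo)%E ->
  int01 g = 0 ->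
  (forall b j, (0 < j)%N -> `|2 * int01 (fun x => g x * trig b j x)| <= C * j%:R `^ (- alpha)) ->
  exists2 Z, 0 <= Z & forall c K, uniq K -> (forall k, k \in K -> (0 < k)%N) ->
    (sq01 (dilated_sum_on c g K) <=
     (Z * \sum_(k <- K) c k ^+ 2 * sigma (1 - 2 * alpha + delta) k)%:E)%E.
Proof.
move=> halpha hdelta mg pg g2 g0 gC.
pose a b n := 2 * int01 (fun x => g x * trig b n x).
have [Z Z0 HZ] := sq01_dilated_trigsum_le a alpha delta C halpha hdelta gC.
have hg b n : int01 (fun x => g x * trig b n x) = if (0 < n)%N then 2^-1 * a b n else 0.
  (* At frequency 0 the sine vanishes and the cosine integral is the mean of [g]. *)
  case: n => [|n] /=; last by rewrite /a mulKf.
  rewrite /trig mulr0; case: b.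
    rewrite (_ : (fun x => _) = fun=> 0) ?int01_cst//.
    by apply/funext => x; rewrite mul0r sin0 mulr0.
  by rewrite -[RHS]g0; congr int01; apply/funext => x; rewrite mul0r cos0 mulr1.
exists (2 * Z); first by rewrite mulr_ge0.
move=> c K uK K0; set S := \sum_(k <- K) _.
apply/lee_addgt0Pr => e e0.
(* An error of square integral e / D is multiplied by at most D - 1: the factor of
   [sq01_dilated_sum_on_le], doubled by [sqintD_le]. Adding 1 keeps [D] positive. *)
pose D : R := 2 * (2 ^+ size K * \sum_(k <- K) c k ^+ 2) + 1.
have D0 : 0 < D.
  by rewrite ltr_wpDl// !mulr_ge0 ?exprn_ge0//; apply: sumr_ge0 => k _; exact: sqr_ge0.
have [N /(_ N (leqnn N)) HN] := fourier_series_cvg a alpha C halpha gC g mg g2 hg (e / D) (divr_gt0 e0 D0).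
have mN : measurable_fun setT (trigsum a N) by case: (bounded_borel_trigsum a N).
have mB : measurable_fun setT (fun x : R => g x - trigsum a N x) by exact: measurable_funB.
rewrite (_ : dilated_sum_on c g K = fun x => dilated_trigsum a c K N x +
    dilated_sum_on c (fun x => g x - trigsum a N x) K x); last first.
  by apply/funext => x; exact: dilated_sum_onB_trigsum.
have mT : measurable_fun setT (dilated_trigsum a c K N) by case: (bounded_borel_dilated_trigsum a c K N).
apply: le_trans (@sqintD_le _ _ _ mu `[0%R, 1%R] (measurable_itv _) _ _ mT (measurable_dilated_sum_on c _ K mB)) _.
rewrite -mulrA EFinM; apply: leeD; first by apply: lee_wpmul2l => //; exact: HZ.
have pB x : g (x + 1) - trigsum a N (x + 1) = g x - trigsum a N x by rewrite pg trigsum1.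
have H1 := sq01_dilated_sum_on_le c _ K K0 mB pB.
have H2 : (sq01 (fun x => g x - trigsum a N x)%R <= (e / D)%:E)%E by rewrite sq01C.
have s0 : 0 <= 2 ^+ size K * \sum_(k <- K) c k ^+ 2.
  by rewrite mulr_ge0 ?exprn_ge0//; apply: sumr_ge0 => k _; exact: sqr_ge0.
apply: (@le_trans _ _ (2%:E * ((2 ^+ size K * \sum_(k <- K) c k ^+ 2)%R%:E * (e / D)%R%:E))%E).
  apply: lee_wpmul2l => //; apply: le_trans H1 _.
  by apply: lee_wpmul2l => //; rewrite lee_fin.
rewrite -!EFinM lee_fin mulrA mulrCA ler_piMr ?(ltW e0)//.
by rewrite ler_pdivrMr// mul1r /D lerDl.
Qed.

End Convergence.

Section DilatedSums.
Context {R : realType}.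
Local Notation mu := (@lebesgue_measure R).
Local Notation leb := (@completed_lebesgue_measure R).
Local Notation sq01 := (sqint mu `[0%R, 1%R]).

Lemma measurable_dilated_sum c (g : R -> R) n :
  measurable_fun setT g -> measurable_fun setT (dilated_sum c g n).
Proof. by move=> mg; exact: measurable_dilated_sum_on. Qed.

(** The preimages of [N] under the dilations by k >= 1 are countably many null sets, so their union
    works for all [c] and [n] at once. *)
Lemma equal_off_dilated_sum (N : set R) (f g : R -> R) : equal_off _ N f g ->
  exists N' : set R, forall c n, equal_off _ N' (dilated_sum c f n) (dilated_sum c g n).
Proof.
move=> [mN N0 fg]; pose F k := affine k.+1%:R 0 @^-1` N.
have mF k : measurable (F k).
  by rewrite -[F k]setTI; exact: (measurable_affine k.+1%:R 0).
exists (\bigcup_k F k) => c n; split.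
- exact: bigcupT_measurable.
- apply/negligibleP; first exact: bigcupT_measurable.
  apply: negligible_bigcup => k; apply/negligibleP; first exact: mF.
  by apply: negligible_affine => //; rewrite ltr0n.
move=> x nx; apply: eq_big_nat => k /andP[k0 _]; rewrite fg// => Nk.
apply: nx; exists k.-1 => //; rewrite /F/= /affine prednK// addr0.
exact: Nk.
Qed.

Lemma sigma_ge0 (s : R) k : 0 <= sigma s k.
Proof. by apply: sumr_ge0 => d _; exact: powR_ge0. Qed.

Lemma nneseries1_bounded (u : nat -> R) : (forall k, 0 <= u k) ->
  (\sum_(1 <= k <oo) (u k)%:E < +oo)%E ->
  exists Z, forall n, \sum_(1 <= k < n.+1) u k <= Z.
Proof.
move=> u0; set s := (\sum_(1 <= k <oo) _)%E => soo.
have s0 : (0 <= s)%E by apply: nneseries_ge0 => k _ _; rewrite lee_fin.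
exists (fine s) => n; rewrite -lee_fin fineK ?ge0_fin_numE// -sumEFin.
by apply: nneseries_lim_ge => k _ _; rewrite lee_fin.
Qed.

Lemma cvge0_le (x : nat -> \bar R) : (forall n, 0 <= x n)%E ->
  (forall e : R, 0 < e -> exists N, forall n, (N <= n)%N -> (x n <= e%:E)%E) ->
  x n @[n --> \oo] --> 0%E.
Proof.
move=> x0 xe; apply/fine_cvgP; split.
  have [N HN] := xe 1 ltr01; exists N => // n /= Nn.
  by rewrite ge0_fin_numE// (le_lt_trans (HN n Nn))// ltry.
apply/cvgrPdist_le => e e0; have [N HN] := xe e e0; exists N => // n /= Nn.
rewrite sub0r normrN ger0_norm ?fine_ge0// -lee_fin fineK ?HN//.
by rewrite ge0_fin_numE// (le_lt_trans (HN n Nn))// ltry.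
Qed.

Lemma class_C_borel (alpha : R) (f : R -> R) : class_C alpha f ->
  exists (g : R -> R) (N : set R) (C : R), [/\ equal_off _ N f g, measurable_fun setT g,
    forall x, g (x + 1) = g x, (sq01 g < +oo)%E & int01 g = 0 /\
    (forall b j, (0 < j)%N -> `|2 * int01 (fun x => g x * trig b j x)| <= C * j%:R `^ (- alpha))].
Proof.
move=> [mf pf f0 f2 [Os Oc]].
have [g [N [fg mg pg]]] := borel_representative f mf pf.
have [C1 C10 HC1] := bigO_powR_bound _ _ Os.
have [C2 C20 HC2] := bigO_powR_bound _ _ Oc.
exists g, N, (C1 + C2); split => //.
  by rewrite -(sqint_equal_off _ _ _ fg mg).
split.
  have E : (\int[leb]_(x in (`[0%R, 1%R]%classic : set (lebesgueR R))) (f x)%:E =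
      \int[mu]_(x in `[0%R, 1%R]) (g x)%:E)%E.
    apply: (@lebesgue_integral_equal_off _ N).
    - by case: fg => mN N0 fg; split => // x Nx; rewrite fg.
    - exact: measurable_itv.
    - exact/measurable_EFinP.
  by rewrite /int01 /Rintegral -E f0.
move=> b j j0; rewrite -(fourier_coefE _ _ _ b j fg mg) mulrDl.
have p0 : 0 <= j%:R `^ (- alpha) by exact: powR_ge0.
case: b; rewrite /fourier_coef.
  by rewrite (le_trans (HC1 j j0))// lerDl mulr_ge0.
by rewrite (le_trans (HC2 j j0))// lerDr mulr_ge0.
Qed.

(** The difference of two partial sums is a sum over an interval of indices, and
    [sq01_dilated_sum_on_bound] controls it by a tail of the convergent weighted series;
    completeness then provides the limit. *)
Lemma cvg_dilated_sum (alpha : R) (f : R -> R) (c : nat -> R) : 2^-1 < alpha ->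
  class_C alpha f ->
  (exists2 eps : R, 0 < eps &
    (\sum_(1 <= k <oo) (c k ^+ 2 * sigma (1 - 2 * alpha + eps) k)%:E < +oo)%E) ->
  cvg_L2 (dilated_sum c f).
Proof.
move=> halpha /class_C_borel [g [N [C [fg mg pg g2 [g0 gC]]]]] [eps eps0 hc].
have [Z Z0 HZ] := sq01_dilated_sum_on_bound g alpha eps C halpha eps0 mg pg g2 g0 gC.
pose u k := c k ^+ 2 * sigma (1 - 2 * alpha + eps) k.
have u0 k : 0 <= u k by rewrite mulr_ge0 ?sqr_ge0 ?sigma_ge0.
have [B HB] := nneseries1_bounded u u0 hc.
have mS n : measurable_fun setT (dilated_sum c g n) by exact: measurable_dilated_sum.
have cauchy (e : R) : 0 < e -> exists N, forall m n, (N <= m)%N -> (N <= n)%N ->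
    (sq01 (fun x => dilated_sum c g m x - dilated_sum c g n x)%R <= e%:E)%E.
  move=> e0; have Z1 : 0 < Z + 1 by rewrite ltr_wpDl.
  have [M HM] := nonneg_tail u B u0 HB (e / (Z + 1)) (divr_gt0 e0 Z1).
  exists M => m n; wlog nm : m n / (n <= m)%N.
    move=> H Nm Nn; have [|/ltnW] := leqP n m; first by move=> /H; apply.
    by move=> /H; rewrite sq01C; apply.
  move=> _ Mn.
  have -> : (fun x => dilated_sum c g m x - dilated_sum c g n x) =
      dilated_sum_on c g (index_iota n.+1 m.+1).
    apply/funext => x; rewrite /dilated_sum (@big_cat_nat _ _ _ n.+1)//=.
    by rewrite [X in X - _]addrC addrK.
  apply: le_trans (HZ c _ (iota_uniq _ _) _) _.
    by move=> k; rewrite mem_index_iota => /andP[/(leq_ltn_trans _)->].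
  rewrite lee_fin; have := HM m n; rewrite Mn nm => /(_ isT) H.
  apply: (@le_trans _ _ (Z * (e / (Z + 1)))); first by rewrite ler_wpM2l.
  rewrite mulrCA ler_piMr ?(ltW e0)// ler_pdivrMr// mul1r.
  by rewrite lerDl.
have [Phi [mPhi HPhi]] := @sqint_complete _ _ R mu `[0%R, 1%R] _ (measurable_itv _) mS cauchy.
pose G (x : R) := Phi (fun n => dilated_sum c g n x).
have mG : measurable_fun setT G by exact: mPhi.
have {}HPhi (e : R) : 0 < e -> exists N, forall n, (N <= n)%N ->
    (sq01 (fun x => dilated_sum c g n x - G x)%R <= e%:E)%E by exact: HPhi.
have mSG n : measurable_fun setT (fun x : R => dilated_sum c g n x - G x) by exact: measurable_funB.
have lG : lebesgue_measurable G by exact: (lebesgue_measurable_equal_off _ _ _ (equal_off_refl _ G) mG).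
have [N' fgS] := equal_off_dilated_sum N f g fg.
have fgSG n : equal_off _ N' (dilated_sum c f n \- G) (fun x => dilated_sum c g n x - G x).
  by case: (fgS c n) => mN' N'0 H; split => // x Nx; rewrite /= H.
exists G; split => //.
- have [M /(_ M (leqnn M)) HM] := HPhi 1 ltr01.
  rewrite L2normE//; apply: poweR_lty.
  rewrite (sqint_equal_off _ _ _ (equal_off_refl _ G) mG).
  rewrite (_ : G = fun x => dilated_sum c g M x + (-1) * (dilated_sum c g M x - G x)); last first.
    by apply/funext => x; rewrite mulN1r opprB addrC subrK.
  have mB' : measurable_fun setT (fun x : R => (-1) * (dilated_sum c g M x - G x)) by exact: measurable_funM.
  apply: le_lt_trans (@sqintD_le _ _ _ mu `[0%R, 1%R] (measurable_itv _) _ _ (mS M) mB') _.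
  rewrite (@sqintZ _ _ _ mu `[0%R, 1%R] (measurable_itv _) (-1) _ (mSG M)); apply: lte_add_pinfty; apply: lte_mul_pinfty => //.
    apply: le_lt_trans (HZ c (index_iota 1 M.+1) (iota_uniq _ _) _) _; last exact: ltry.
    by move=> k; rewrite mem_index_iota => /andP[].
  by rewrite sqrrN expr1n mul1e (le_lt_trans HM)// ltry.
- apply: cvge0_le => [n|e e0]; first exact: Lnorm_ge0.
  have [M HM] := HPhi (e ^+ 2) (exprn_gt0 _ e0); exists M => n Mn.
  apply: le_L2norm => //.
    exact: (lebesgue_measurable_equal_off _ _ _ (fgSG n)).
  by rewrite (sqint_equal_off _ _ _ (fgSG n))// HM.
Qed.

End DilatedSums.

(** * Divergence *)

Section DivisorSums.
Context {R : realType}.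

Lemma ler_sum_subseq (I : eqType) (s t : seq I) (F : I -> R) : uniq s -> uniq t ->
  {subset s <= t} -> (forall i, 0 <= F i) -> \sum_(i <- s) F i <= \sum_(i <- t) F i.
Proof.
move=> us ut st F0; rewrite [leRHS](bigID (mem s))/=.
rewrite (perm_big [seq i <- t | i \in s]).
  by rewrite big_filter lerDl sumr_ge0.
apply: uniq_perm => //; first exact: filter_uniq.
by move=> x; rewrite mem_filter; case: (boolP (x \in s)) => //= /st ->.
Qed.

Lemma mem_divisors d n : (0 < n)%N -> (d \in divisors n) = (d %| n)%N.
Proof. by move=> n0; rewrite dvdn_divisors. Qed.

Lemma le_sigma (s : R) m n : (0 < n)%N -> (m %| n)%N -> sigma s m <= sigma s n.
Proof.
move=> n0 mn; have m0 := dvdn_gt0 n0 mn.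
apply: ler_sum_subseq; rewrite ?divisors_uniq// => d.
by rewrite !mem_divisors// => /dvdn_trans; apply.
Qed.

(** A divisor [d] of m n is the product of a = gcd(d, m) and of d / a, which divides [n]. Distinct
    pairs may share a product, hence only an inequality. *)
Lemma sigma_submul (s : R) m n : (0 < m)%N -> (0 < n)%N ->
  sigma s (m * n) <= sigma s m * sigma s n.
Proof.
move=> m0 n0; have mn0 : (0 < m * n)%N by rewrite muln_gt0 m0.
pose w (a b : nat) : R := a%:R `^ s * b%:R `^ s.
have w0 a b : 0 <= w a b by rewrite mulr_ge0 ?powR_ge0.
rewrite /sigma big_distrlr/=.
apply: (@le_trans _ _ (\sum_(d <- divisors (m * n)) \sum_(a <- divisors m)
    \sum_(b <- divisors n) ((a * b)%N == d)%:R * w a b)).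
  rewrite big_seq [leRHS]big_seq; apply: ler_sum => d; rewrite mem_divisors// => dmn.
  pose a := gcdn d m; pose b := (d %/ a)%N.
  have a0 : (0 < a)%N by rewrite gcdn_gt0 m0 orbT.
  have abE : (a * b = d)%N by rewrite mulnC divnK// dvdn_gcdl.
  have bn : (b %| n)%N.
    have cop : coprime b (m %/ a).
      by rewrite /coprime -(eqn_pmul2l a0) muln_gcdr abE [(a * (m %/ a))%N]mulnC divnK ?dvdn_gcdr// muln1.
    rewrite -(Gauss_dvdr _ cop) -(dvdn_pmul2l a0) abE mulnA.
    by rewrite [(a * (m %/ a))%N]mulnC divnK ?dvdn_gcdr.
  have T0 a1 b1 : 0 <= ((a1 * b1)%N == d)%:R * w a1 b1 by rewrite mulr_ge0.
  apply: le_trans (@ler_sum_mem R _ _ a _ _ _); last 2 first.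
  - by move=> a1; apply: sumr_ge0.
  - by rewrite mem_divisors// dvdn_gcdr.
  apply: le_trans (@ler_sum_mem R _ _ b _ _ _) => //; last by rewrite mem_divisors.
  by rewrite abE eqxx mul1r /w -powRM// -natrM abE.
rewrite exchange_big/=; apply: ler_sum => a _.
rewrite exchange_big/=; apply: ler_sum => b _.
rewrite -mulr_suml ler_piMl//.
by apply: le_trans (sum_eq_le1 _ _ _ (divisors_uniq _)) _; case: (_ \in _).
Qed.

(* Pair [n] with [Q / n]: by AM-GM and submultiplicativity
   [sigma n ^ 2 + sigma (Q / n) ^ 2 >= 2 sigma n * sigma (Q / n) >= 2 sigma Q]. *)
Lemma size_divisors_sigma_le (s : R) Q : (0 < Q)%N ->
  (size (divisors Q))%:R * sigma s Q <= \sum_(n <- divisors Q) sigma s n ^+ 2.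
Proof.
move=> Q0; pose D := divisors Q.
have DQ n : n \in D -> (0 < n)%N /\ (n * (Q %/ n))%N = Q.
  rewrite mem_divisors// => nQ; split; first exact: dvdn_gt0 nQ.
  by rewrite mulnC divnK.
have flip : \sum_(n <- D) sigma s (Q %/ n) ^+ 2 = \sum_(n <- D) sigma s n ^+ 2.
  rewrite -(big_map (fun n => Q %/ n)%N predT (fun n => sigma s n ^+ 2)).
  apply: perm_big; have inj : {in D &, injective (fun n => Q %/ n)%N}.
    move=> m n mD nD E; have [m0 mE] := DQ m mD; have [n0 nE] := DQ n nD.
    have : (m * (Q %/ m) = n * (Q %/ m))%N by rewrite mE E nE.
    move/eqP; rewrite eqn_pmul2r; first by move/eqP.
    by rewrite divn_gt0// dvdn_leq// -mem_divisors.
  apply: uniq_perm; rewrite ?map_inj_in_uniq ?divisors_uniq//.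
  move=> x; apply/mapP/idP => [[n nD ->]|xD].
    by rewrite mem_divisors//; have [_ <-] := DQ n nD; rewrite mulKn ?dvdn_mull//; case: (DQ n nD).
  have [x0 xE] := DQ x xD; exists (Q %/ x)%N; first by rewrite mem_divisors// -{2}xE dvdn_mull.
  set q := (Q %/ x)%N in xE *; have q0 : (0 < q)%N by move: Q0; rewrite -xE muln_gt0 x0.
  by rewrite -xE mulnK.
have : \sum_(n <- D) sigma s Q <= \sum_(n <- D) 2^-1 * (sigma s n ^+ 2 + sigma s (Q %/ n) ^+ 2).
  rewrite big_seq [leRHS]big_seq; apply: ler_sum => n nD.
  have [n0 nE] := DQ n nD.
  have q0 : (0 < Q %/ n)%N by move: Q0; rewrite -{1}nE muln_gt0 n0.
  have := sigma_submul s _ _ n0 q0; rewrite nE => /le_trans; apply.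
  by have := sqr_ge0 (sigma s n - sigma s (Q %/ n)); nra.
rewrite -mulr_sumr big_split/= flip big_const_seq count_predT iter_addr_0 mulr_natl.
by rewrite -/D; lra.
Qed.

(** Every j with 1 <= j <= N divides N!, and each of these [N] divisors contributes at least
    N^-s. *)
Lemma sigma_fact_ge (s : R) N : 0 <= s <= 1 -> N%:R `^ (1 - s) <= sigma (- s) N`!.
Proof.
move=> /andP[s0 s1]; have [->|N0] := posnP N.
  (* For N = 0 the left side is 0, or 1 if s = 1, while the right side is 1. *)
  rewrite [leLHS](_ : _ = 0 `^ (1 - s))// /sigma /= big_seq1.
  rewrite powR1; have [->|s1'] := eqVneq (1 - s) 0; first by rewrite powRr0.
  by rewrite powR0.
apply: (@le_trans _ _ (\sum_(1 <= j < N.+1) j%:R `^ (- s))).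
  apply: (@le_trans _ _ (\sum_(1 <= j < N.+1) N%:R `^ (- s))).
    rewrite sumr_const_nat subSS subn0 -[leRHS]mulr_natl.
    rewrite powRD; last by rewrite pnatr_eq0 -lt0n N0 implybT.
    by rewrite powRr1.
  apply: ler_sum_nat => j /andP[j0 jN].
  rewrite !powRN lef_pV2 ?posrE ?natpowR_gt0//.
  by rewrite ge0_ler_powR ?nnegrE// ler_nat.
apply: ler_sum_subseq; rewrite ?iota_uniq ?divisors_uniq// => j.
rewrite mem_index_iota ltnS mem_divisors ?fact_gt0// => /andP[j0 jN].
by rewrite dvdn_fact// j0.
Qed.

Lemma le_count_divisors (K Q : nat) : (0 < Q)%N ->
  \sum_(1 <= k < K.+1) (k %| Q)%N%:R <= (size (divisors Q))%:R :> R.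
Proof.
move=> Q0; set I := index_iota 1 K.+1.
have -> : \sum_(k <- I) (k %| Q)%N%:R = (count (fun k => k %| Q)%N I)%:R :> R.
  rewrite -sum1_count natr_sum [RHS]big_mkcond/=.
  by apply: eq_bigr => k _; case: (_ %| _)%N.
rewrite ler_nat -size_filter; apply: uniq_leq_size; first exact/filter_uniq/iota_uniq.
by move=> k; rewrite mem_filter mem_divisors// => /andP[].
Qed.

Lemma sigma_ge1 (s : R) n : (0 < n)%N -> 1 <= sigma s n.
Proof.
move=> n0; have -> : 1 = 1%:R `^ s :> R by rewrite powR1.
apply: (@ler_sum_mem R _ _ 1%N (fun d => d%:R `^ s)).
  by move=> d; exact: powR_ge0.
by rewrite divisor1.
Qed.

Lemma dvdn_fact_fact m n : (m <= n)%N -> (m`! %| n`!)%N.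
Proof.
move=> /subnKC <-; elim: (n - m)%N => [|k ih]; first by rewrite addn0.
by rewrite addnS factS dvdn_mull.
Qed.

End DivisorSums.

Section Weights.
Context {R : realType} (alpha beta : R).
Context (halpha : 0 <= alpha < 1) (hbeta : 0 <= beta < 1).
Local Notation s := (@sigma R (- alpha)).

(** The exponent is chosen so that sigma_(-alpha)(N!) >= N^(1 - alpha) becomes at least 4^r after
    raising to 1 - beta. The summand [r] ensures that [k] divides [modulus k], so every [k] lies in
    some block. *)
Definition level (r : nat) : nat :=
  (Num.truncn ((4 : R) `^ (r%:R / ((1 - alpha) * (1 - beta)))) + r).+1.

Definition modulus (r : nat) : nat := (level r)`!.

(* [weight r] is the square of the coefficient spread over the divisors of [modulus r]: that
   block contributes at most [2 ^- r] to the weighted series, but at least a multiple of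
   [2 ^- r * sigma (- alpha) (modulus r) `^ (1 - beta) >= 2 ^ r] to the squared norm. *)
Definition weight (r : nat) : R :=
  2^-1 ^+ r / ((size (divisors (modulus r)))%:R * s (modulus r) `^ beta).

(* The default value [k.+1] of [find] is reached only at [k = 0]. *)
Definition rank (k : nat) : nat := find (fun r => k %| modulus r)%N (iota 0 k.+1).

(** Weights decrease, so the first block containing [k] has the largest weight: the coefficient
    dominates what every block containing [k] asks for. *)
Definition coefficient (k : nat) : R := Num.sqrt (weight (rank k)).

Lemma modulus_gt0 r : (0 < modulus r)%N.
Proof. exact: fact_gt0. Qed.

Lemma modulus_dvd m n : (m <= n)%N -> (modulus m %| modulus n)%N.
Proof.
move=> mn; apply: dvdn_fact_fact; rewrite ltnS leq_add//.
apply: le_truncn; rewrite ler_powR ?ler1n//.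
have /andP[_ a1] := halpha; have /andP[_ b1] := hbeta.
by rewrite ler_wpM2r ?ler_nat// invr_ge0 mulr_ge0 ?subr_ge0 ?ltW.
Qed.

Lemma sigma_modulus_ge r : 4 ^+ r <= s (modulus r) `^ (1 - beta).
Proof.
have /andP[a0 a1] := halpha; have /andP[b0 b1] := hbeta.
have a1' : 0 < 1 - alpha by rewrite subr_gt0.
have b1' : 0 < 1 - beta by rewrite subr_gt0.
pose x : R := 4 `^ (r%:R / ((1 - alpha) * (1 - beta))).
have xN : x <= (level r)%:R.
  apply: (@le_trans _ _ (Num.truncn x).+1%:R); first exact/ltW/truncnS_gt.
  by rewrite ler_nat ltnS leq_addr.
have -> : 4 ^+ r = (x `^ (1 - alpha)) `^ (1 - beta).
  rewrite -!powRrM -[LHS]powR_mulrn//; congr powR.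
  by field; rewrite !gt_eqF.
apply: ge0_ler_powR; rewrite ?nnegrE ?powR_ge0 ?sigma_ge0 ?(ltW b1')//.
apply: le_trans (sigma_fact_ge alpha (level r) _); last by rewrite a0 ltW.
by apply: ge0_ler_powR; rewrite ?nnegrE ?powR_ge0 ?(ltW a1').
Qed.

Lemma sigma_modulus_gt0 r : 0 < s (modulus r).
Proof. by rewrite (lt_le_trans ltr01)// sigma_ge1// modulus_gt0. Qed.

Lemma size_divisors_gt0 n : (0 < size (divisors n))%N.
Proof. by case: (divisors n) (divisor1 n). Qed.

Lemma weight_gt0 r : 0 < weight r.
Proof.
rewrite divr_gt0 ?exprn_gt0 ?invr_gt0//.
by rewrite mulr_gt0 ?powR_gt0 ?sigma_modulus_gt0// ltr0n size_divisors_gt0.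
Qed.

Lemma weight_decreasing m n : (m <= n)%N -> weight n <= weight m.
Proof.
move=> mn; have d := modulus_dvd m n mn.
apply: ler_pM.
- by rewrite exprn_ge0 ?invr_ge0.
- by rewrite invr_ge0 mulr_ge0 ?powR_ge0.
- by rewrite ler_wiXn2l ?invr_ge0// invf_le1// ler1n.
have /andP[b0 _] := hbeta.
rewrite lef_pV2 ?posrE; first last.
- by rewrite mulr_gt0 ?powR_gt0 ?sigma_modulus_gt0// ltr0n size_divisors_gt0.
- by rewrite mulr_gt0 ?powR_gt0 ?sigma_modulus_gt0// ltr0n size_divisors_gt0.
apply: ler_pM; rewrite ?powR_ge0//.
  rewrite ler_nat; apply: uniq_leq_size; first exact: divisors_uniq.
  by move=> k; rewrite !mem_divisors ?modulus_gt0// => /dvdn_trans; apply.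
apply: ge0_ler_powR; rewrite ?nnegrE ?sigma_ge0//.
by apply: le_sigma => //; exact: modulus_gt0.
Qed.

Lemma rank_le k r : (0 < k)%N -> (k %| modulus r)%N -> (rank k <= r)%N.
Proof.
move=> k0 kr; rewrite leqNgt; apply/negP => H.
have rk : (r < k.+1)%N.
  by apply: leq_trans H _; rewrite -[X in (_ <= X)%N](size_iota 0) find_size.
by have := before_find 0%N H; rewrite nth_iota// add0n kr.
Qed.

Lemma rankP k : (0 < k)%N -> (rank k <= k)%N /\ (k %| modulus (rank k))%N.
Proof.
move=> k0; have kk : (k %| modulus k)%N.
  by apply: dvdn_fact; rewrite k0/= (leq_trans _ (leqnSn _))// leq_addl.
split; first exact: rank_le.
have H : has (fun r => k %| modulus r)%N (iota 0 k.+1).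
  by apply/hasP; exists k => //; rewrite mem_iota add0n ltnSn.
have := nth_find 0%N H; rewrite -/(rank k) nth_iota ?add0n//.
by rewrite ltnS rank_le.
Qed.

Lemma coefficient_sqr k : coefficient k ^+ 2 = weight (rank k).
Proof. by rewrite sqr_sqrtr// ltW// weight_gt0. Qed.

Lemma coefficient_ge0 k : 0 <= coefficient k.
Proof. exact: sqrtr_ge0. Qed.

Lemma coefficient_ge k r : (0 < k)%N -> (k %| modulus r)%N ->
  Num.sqrt (weight r) <= coefficient k.
Proof. by move=> k0 kr; rewrite ler_wsqrtr// weight_decreasing// rank_le. Qed.

(** Charge [k] to its block of rank [rank k], then enlarge to all blocks containing [k]. Block [r]
    has at most tau(Q) members, each costing at most [weight r] times sigma(Q)^beta, hence 2^-r
    altogether. *)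
Lemma sum_coefficient_le n :
  \sum_(1 <= k < n.+1) coefficient k ^+ 2 * s k `^ beta <= 2.
Proof.
have /andP[b0 _] := hbeta; pose I := index_iota 1 n.+1; pose J := index_iota 0 n.+1.
have w0 r : 0 <= weight r by rewrite ltW// weight_gt0.
apply: (@le_trans _ _ (\sum_(k <- I) \sum_(r <- J)
    weight r * s (modulus r) `^ beta * (k %| modulus r)%N%:R)).
  rewrite big_seq [leRHS]big_seq; apply: ler_sum => k.
  rewrite mem_index_iota ltnS => /andP[k0 kn]; have [rk kd] := rankP k k0.
  apply: le_trans (@ler_sum_mem R _ _ (rank k) _ _ _); last 2 first.
  - by move=> r; apply: mulr_ge0 => //; apply: mulr_ge0 => //; exact: powR_ge0.
  - by rewrite mem_index_iota ltnS (leq_trans rk).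
  rewrite kd mulr1 coefficient_sqr ler_wpM2l//.
  apply: ge0_ler_powR; rewrite ?nnegrE ?sigma_ge0//.
  by apply: le_sigma => //; exact: modulus_gt0.
rewrite exchange_big/=.
apply: (@le_trans _ _ (\sum_(r <- J) 2^-1 ^+ r)).
  apply: ler_sum => r _; rewrite -mulr_sumr.
  apply: (@le_trans _ _ (weight r * s (modulus r) `^ beta * (size (divisors (modulus r)))%:R)).
    by rewrite ler_wpM2l ?le_count_divisors ?modulus_gt0// mulr_ge0 ?powR_ge0.
  rewrite /weight -mulrA [X in _ * X]mulrC divfK//.
  by rewrite mulf_neq0// gt_eqF ?powR_gt0 ?sigma_modulus_gt0// ltr0n size_divisors_gt0.
rewrite big_mkord.
have := subrX1 (2^-1 : R) n.+1.
have : 0 <= (2^-1 : R) ^+ n.+1 by rewrite exprn_ge0 ?invr_ge0.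
by lra.
Qed.

End Weights.

Section LowerBound.
Context {R : realType}.

(** A quadruple with j k = i l appears on the left only for n = j k, at most once, and nonnegativity
    allows the values outside [D] to be dropped. *)
Lemma square_sums_le (x : nat -> nat -> R) (I K D : seq nat) : (forall k j, 0 <= x k j) ->
  uniq D ->
  \sum_(n <- D) (\sum_(k <- K) \sum_(j <- I) (j * k == n)%N%:R * x k j) ^+ 2 <=
  \sum_(k <- K) \sum_(l <- K) \sum_(j <- I) \sum_(i <- I)
    (j * k == i * l)%N%:R * (x k j * x l i).
Proof.
move=> x0 uD.
under eq_bigr => n _.
  rewrite expr2 big_distrlr/=; under eq_bigr do under eq_bigr do rewrite big_distrlr/=.
  over.
rewrite exchange_big/=; apply: ler_sum => k _.
rewrite exchange_big/=; apply: ler_sum => l _.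
rewrite exchange_big/=; apply: ler_sum => j _.
rewrite exchange_big/=; apply: ler_sum => i _.
under eq_bigr do rewrite mulrACA.
rewrite -mulr_suml ler_wpM2r ?mulr_ge0//.
have [<-|ne] := eqVneq (j * k)%N (i * l)%N.
  apply: (@le_trans _ _ (\sum_(n <- D) ((j * k)%N == n)%:R)).
    by apply: ler_sum => n _; case: (_ == _); rewrite ?mul0r ?mul1r.
  by apply: le_trans (sum_eq_le1 _ _ _ uD) _; case: (_ \in _).
rewrite big1// => n _; case: eqP => [<-|]; last by rewrite mul0r.
by rewrite eq_sym (negbTE ne) mulr0.
Qed.

(** Keep only the terms with j | n and k = n / j; such a [k] divides [n] as well, so its coefficient
    is at least [t]. *)
Lemma divisor_sum_ge (alpha t : R) (c : nat -> R) (n M P : nat) :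
  (0 < n)%N -> (n <= M)%N -> (n <= P)%N -> (forall k, 0 <= c k) ->
  (forall k, (k %| n)%N -> t <= c k) ->
  t * sigma (- alpha) n <=
  \sum_(1 <= k < M.+1) \sum_(1 <= j < P.+1) (j * k == n)%N%:R * (c k * j%:R `^ (- alpha)).
Proof.
move=> n0 nM nP c0 tc; rewrite exchange_big/=.
have T0 (j k : nat) : 0 <= (j * k == n)%N%:R * (c k * j%:R `^ (- alpha)).
  by rewrite !mulr_ge0 ?powR_ge0.
apply: (@le_trans _ _ (\sum_(j <- divisors n) \sum_(1 <= k < M.+1)
    (j * k == n)%N%:R * (c k * j%:R `^ (- alpha)))); last first.
  apply: ler_sum_subseq; rewrite ?divisors_uniq ?iota_uniq//.
    move=> j; rewrite mem_divisors// mem_index_iota ltnS => jn.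
    by rewrite (dvdn_gt0 n0 jn) (leq_trans (dvdn_leq n0 jn)).
  by move=> j; apply: sumr_ge0.
rewrite mulr_sumr big_seq [leRHS]big_seq; apply: ler_sum => j; rewrite mem_divisors// => jn.
have j0 := dvdn_gt0 n0 jn.
have q0 : (0 < n %/ j)%N by rewrite divn_gt0// dvdn_leq.
have qE : (j * (n %/ j) = n)%N by rewrite mulnC divnK.
apply: le_trans (@ler_sum_mem R _ _ (n %/ j)%N _ _ _) => //; last first.
  by rewrite mem_index_iota q0 ltnS (leq_trans (leq_div _ _)).
rewrite qE eqxx mul1r ler_wpM2r ?powR_ge0// tc//.
by rewrite -{2}qE dvdn_mull.
Qed.

End LowerBound.

Section Divergence.
Context {R : realType} (alpha beta : R).
Context (halpha : 2^-1 < alpha < 1) (hbeta : 0 < beta < 1).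
Local Notation mu := (@lebesgue_measure R).
Local Notation leb := (@completed_lebesgue_measure R).
Local Notation sq01 := (sqint mu `[0%R, 1%R]).
Local Notation c := (coefficient alpha beta).

Definition sine_coef (b : bool) (j : nat) : R := if b then j%:R `^ (- alpha) else 0.

Let halpha0 : 0 <= alpha < 1.
Proof. by case/andP: halpha => a0 ->; rewrite andbT; lra. Qed.

Let hbeta0 : 0 <= beta < 1.
Proof. by case/andP: hbeta => b0 ->; rewrite ltW. Qed.

Lemma sine_coef_le b j : (0 < j)%N -> `|sine_coef b j| <= 1 * j%:R `^ (- alpha).
Proof.
by move=> _; rewrite mul1r; case: b; rewrite /sine_coef ?normr0 ?powR_ge0// ger0_norm ?powR_ge0.
Qed.

Lemma sq01_dilated_trigsum_ge (r M P : nat) :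
  (modulus alpha beta r <= M)%N -> (modulus alpha beta r <= P)%N ->
  ((2^-1 * 2 ^+ r)%:E <= sq01 (dilated_trigsum sine_coef c (index_iota 1 M.+1) P))%E.
Proof.
set Q := modulus alpha beta r => QM QP.
have Q0 : (0 < Q)%N by exact: modulus_gt0.
have c0 k : 0 <= c k by exact: coefficient_ge0.
rewrite sq01_dilated_trigsum; last by move=> k; rewrite mem_index_iota => /andP[].
rewrite lee_fin.
pose x (k j : nat) := c k * j%:R `^ (- alpha).
have x0 k j : 0 <= x k j by rewrite mulr_ge0 ?powR_ge0.
set w := weight alpha beta r; have w0 : 0 < w by exact: weight_gt0.
apply: (@le_trans _ _ (2^-1 * \sum_(n <- divisors Q) (Num.sqrt w * sigma (- alpha) n) ^+ 2)).
  rewrite ler_pM2l ?invr_gt0//; under eq_bigr do rewrite exprMn sqr_sqrtr ?(ltW w0)//.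
  rewrite -mulr_sumr.
  have := size_divisors_sigma_le (- alpha) Q Q0.
  rewrite -(ler_pM2l w0); apply: le_trans.
  have s0 : 0 < sigma (- alpha) Q by exact: sigma_modulus_gt0.
  have -> : w * ((size (divisors Q))%:R * sigma (- alpha) Q) =
      2^-1 ^+ r * sigma (- alpha) Q `^ (1 - beta).
    rewrite /w /weight -/Q powRB; last by rewrite (gt_eqF s0) implybT.
    rewrite powRr1 ?(ltW s0)//; field.
    by rewrite !gt_eqF ?powR_gt0// ltr0n size_divisors_gt0.
  apply: (@le_trans _ _ (2^-1 ^+ r * 4 ^+ r)).
    by rewrite -exprMn (_ : 2^-1 * 4 = 2 :> R)//; field.
  by rewrite ler_pM2l ?exprn_gt0 ?invr_gt0//; exact: sigma_modulus_ge.
apply: (@le_trans _ _ (2^-1 * \sum_(n <- divisors Q)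
    (\sum_(1 <= k < M.+1) \sum_(1 <= j < P.+1) (j * k == n)%N%:R * x k j) ^+ 2)).
  rewrite ler_pM2l ?invr_gt0// big_seq [leRHS]big_seq; apply: ler_sum => n.
  rewrite mem_divisors// => nQ; have n0 := dvdn_gt0 Q0 nQ; have nleQ := dvdn_leq Q0 nQ.
  have s0 : 0 <= Num.sqrt w * sigma (- alpha) n by rewrite mulr_ge0 ?sqrtr_ge0 ?sigma_ge0.
  have H : Num.sqrt w * sigma (- alpha) n <=
      \sum_(1 <= k < M.+1) \sum_(1 <= j < P.+1) (j * k == n)%N%:R * x k j.
    apply: divisor_sum_ge => //; [exact: leq_trans QM|exact: leq_trans QP|].
    move=> k kn; apply: coefficient_ge => //; first exact: dvdn_gt0 kn.
    exact: dvdn_trans nQ.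
  by rewrite lerXn2r ?nnegrE// (le_trans s0).
apply: le_trans (ler_wpM2l _ (square_sums_le x _ _ _ x0 (divisors_uniq Q))) _.
  by rewrite invr_ge0.
rewrite le_eqVlt; apply/orP; left; apply/eqP.
rewrite mulr_sumr; apply: eq_bigr => k _; rewrite mulr_sumr; apply: eq_bigr => l _.
rewrite mulr_sumr; apply: eq_bigr => j _; rewrite mulr_sumr; apply: eq_bigr => i _.
by rewrite big_bool/= /sine_coef mulr0 addr0 /x; ring.
Qed.

(** A limit in square norm would bound the square integrals of all late partial sums, against the
    lower bound 2^r / 2 obtained as soon as a partial sum covers block [r]. *)
Lemma not_cvg_dilated_sum (G : R -> R) : measurable_fun setT G ->
  (forall x, G (x + 1) = G x) ->
  (forall e, 0 < e -> exists N, forall P, (N <= P)%N ->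
    (sq01 (fun x => trigsum sine_coef P x - G x)%R <= e%:E)%E) ->
  ~ cvg_L2 (dilated_sum c G).
Proof.
move=> mG pG HG [g [mg g2 cv]].
have mI : measurable (`[0%R, 1%R]%classic : set (lebesgueR R)).
  by apply: borel_lebesgue_measurable_set; exact: measurable_itv.
have mS N : measurable_fun setT (dilated_sum c G N) by exact: measurable_dilated_sum.
have lS N : lebesgue_measurable (dilated_sum c G N).
  exact: (lebesgue_measurable_equal_off _ _ _ (equal_off_refl _ _) (mS N)).
have lSg N : lebesgue_measurable (dilated_sum c G N \- g) by exact: measurable_funB (lS N) mg.
have [N0 HN0] : exists N0, forall N, (N0 <= N)%N -> (L2norm (dilated_sum c G N \- g)%R <= 1%:E)%E.
  have /fine_cvgP[[N1 _ HN1] /cvgrPdist_le/(_ 1 ltr01)[N2 _ HN2]] := cv.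
  exists (maxn N1 N2) => N; rewrite geq_max => /andP[h1 h2].
  rewrite -[leLHS]fineK ?HN1// lee_fin; have := HN2 N h2.
  by rewrite sub0r normrN; apply: le_trans; exact: ler_norm.
have fg : (sqint leb (`[0%R, 1%R]%classic : set (lebesgueR R)) g < +oo)%E by exact: lt_sqint_L2norm.
set B := sqint leb _ g in fg.
have B0 : (0 <= B)%E by exact: sqint_ge0.
have HB N : (N0 <= N)%N -> (sq01 (dilated_sum c G N) <= (2 + 2 * fine B)%:E)%E.
  move=> NN; rewrite -(sqint_equal_off _ _ _ (equal_off_refl _ _) (mS N)).
  have -> : dilated_sum c G N = (fun x => (dilated_sum c G N \- g)%R x + g x)%R.
    by apply/funext => x; rewrite /= subrK.
  apply: le_trans (@sqintD_le _ _ _ leb _ mI _ _ (lSg N) mg) _.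
  rewrite [leRHS]EFinD; apply: leeD.
    have := sqint_le_L2norm _ _ ltr01 (lSg N) (HN0 N NN); rewrite expr1n => H.
    by rewrite -[leRHS]mule1; apply: lee_wpmul2l.
  by rewrite EFinM fineK ?ge0_fin_numE.
(* The target is twice the supposed bound plus twice a truncation error of at most 1, both doublings
   coming from [sqintD_le]. *)
have hb : exists r : nat, 2 * (2 + 2 * fine B) + 2 < 2^-1 * 2 ^+ r.
  pose y : R := 2 * (2 * (2 + 2 * fine B) + 2).
  exists (Num.truncn y).+1.
  have : y < 2 ^+ (Num.truncn y).+1.
    apply: lt_le_trans (truncnS_gt y) _.
    by rewrite -natrX ler_nat ltnW// ltn_expl.
  by move: (2 ^+ (Num.truncn y).+1) => T; rewrite /y; lra.
have [r hr] := hb; set Q := modulus alpha beta r.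
(* Beyond [N0] the supposed bound holds; beyond [Q] the partial sum contains all divisors of [Q]. *)
pose N := maxn N0 Q; pose K := index_iota 1 N.+1.
have K0 k : k \in K -> (0 < k)%N by rewrite mem_index_iota => /andP[].
pose D : R := 2 ^+ size K * \sum_(k <- K) c k ^+ 2.
have D0 : 0 <= D by rewrite mulr_ge0 ?exprn_ge0// sumr_ge0// => k _; rewrite sqr_ge0.
have D1 : 0 < (D + 1)^-1 by rewrite invr_gt0 ltr_wpDl.
have [P0 HP0] := HG _ D1; pose P := maxn P0 Q.
have HP := HP0 P (leq_maxl _ _).
have mP : measurable_fun setT (trigsum sine_coef P) by case: (bounded_borel_trigsum sine_coef P).
have mPG : measurable_fun setT (fun x : R => trigsum sine_coef P x - G x) by exact: measurable_funB.
have pPG x : trigsum sine_coef P (x + 1) - G (x + 1) = trigsum sine_coef P x - G x.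
  by rewrite pG trigsum1.
have L := sq01_dilated_trigsum_ge r N P (leq_maxr _ _) (leq_maxr _ _).
have E : dilated_trigsum sine_coef c K P =
    fun x => dilated_sum c G N x + dilated_sum_on c (fun x => trigsum sine_coef P x - G x) K x.
  apply/funext => x; rewrite /dilated_trigsum /dilated_sum /dilated_sum_on -big_split/=.
  by apply: eq_bigr => k _; rewrite -mulrDr addrC subrK.
rewrite -/K E in L.
have := le_trans L (@sqintD_le _ _ _ mu `[0%R, 1%R] (measurable_itv _) _ _ (mS N) (measurable_dilated_sum_on c _ K mPG)).
apply/negP; rewrite -ltNge.
apply: (@le_lt_trans _ _ (2%:E * (2 + 2 * fine B)%R%:E + 2%:E)%E); last first.
  by rewrite -EFinM -EFinD lte_fin.
apply: leeD; first by apply: lee_wpmul2l => //; apply: HB; exact: leq_maxl.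
rewrite -[leRHS]mule1; apply: lee_wpmul2l => //.
apply: le_trans (sq01_dilated_sum_on_le c _ K K0 mPG pPG) _.
apply: (@le_trans _ _ (D%:E * ((D + 1)^-1)%:E)%E); first by apply: lee_wpmul2l => //; rewrite lee_fin.
by rewrite -EFinM lee_fin ler_pdivrMr ?mul1r ?lerDl// ltr_wpDl.
Qed.

Lemma divergent_example : exists (f : R -> R) (c : nat -> R),
  [/\ class_C alpha f,
    (\sum_(1 <= k <oo) (c k ^+ 2 * (sigma (- alpha) k) `^ beta)%:E < +oo)%E
  & ~ cvg_L2 (dilated_sum c f)].
Proof.
have /andP[a0 a1] := halpha.
have [G [mG pG G2 HG]] := trig_series_exists sine_coef alpha 1 a0 sine_coef_le.
have coefG := int01_trig_series sine_coef G mG G2 HG.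
exists G, c; split; last exact: not_cvg_dilated_sum.
- have off := equal_off_refl _ G.
  have fc b n : (0 < n)%N -> fourier_coef G b n = sine_coef b n.
    move=> n0; rewrite (fourier_coefE _ _ _ b n off mG) coefG n0 mulVKf//.
  have bigO b : (fourier_coef G b : nat -> R^o) =O_\oo (fun j => j%:R `^ (- alpha) : R^o).
    apply/eqO_exP; exists 1 => //; exists 1%N => // n /= n0.
    by rewrite fc// (le_trans (sine_coef_le b n n0))// ler_wpM2l// ler_norm.
  split => //; last by split; [exact: (bigO true) | exact: (bigO false)].
  + exact: (lebesgue_measurable_equal_off _ _ _ off mG).
  + have [iG _] := sq01_integrable _ mG G2.
    have E : (\int[leb]_(x in (`[0%R, 1%R]%classic : set (lebesgueR R))) (G x)%:E =
        \int[mu]_(x in `[0%R, 1%R]) (G x)%:E)%E.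
      apply: (@lebesgue_integral_equal_off _ set0).
      - exact: equal_off_refl.
      - exact: measurable_itv.
      - exact/measurable_EFinP.
    rewrite E.
    (* The mean of [G] is its cosine integral at frequency 0, which vanishes since the series starts
       at frequency 1. *)
    have := coefG false 0%N; rewrite /= (_ : (fun x => _) = G).
      rewrite /int01 /Rintegral => H; rewrite -[LHS]fineK ?H//.
      exact: integrable_fin_num.
    by apply/funext => x; rewrite /trig mulr0 mul0r cos0 mulr1.
  + have := sqint_equal_off _ _ _ off mG; rewrite /sqint => ->; exact: G2.
- apply: (@le_lt_trans _ _ 2%:E); last exact: ltry.
  apply: lime_le; first by apply: is_cvg_nneseries => k _ _; rewrite lee_fin mulr_ge0 ?sqr_ge0 ?powR_ge0.
  apply: nearW => n; rewrite sumEFin lee_fin.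
  case: n => [|n]; first by rewrite big_geq.
  exact: sum_coefficient_le.
Qed.

End Divergence.

Theorem theorem3 (R : realType) (alpha : R) (halpha : 2^-1 < alpha < 1) :
  (forall (f : R -> R) (c : nat -> R),
     class_C alpha f ->
     (exists2 eps : R, 0 < eps &
        (\sum_(1 <= k <oo) (c k ^+ 2 * sigma (1 - 2 * alpha + eps) k)%:E < +oo)%E) ->
     cvg_L2 (dilated_sum c f))
  /\
  (forall beta : R, 0 < beta < 1 ->
     exists (f : R -> R) (c : nat -> R),
       [/\ class_C alpha f,
           (\sum_(1 <= k <oo) (c k ^+ 2 * (sigma (- alpha) k) `^ beta)%:E < +oo)%E
         & ~ cvg_L2 (dilated_sum c f)]).
Proof.
have /andP[alpha_gt alpha_lt] := halpha; split.
  by move=> f c; exact: cvg_dilated_sum.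
by move=> beta hbeta; exact: divergent_example.
Qed.
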